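(* For any $\alpha\in\overline{\mathbb{R}}=[-\infty,+\infty]$ the dynamical system $(\Omega_\alpha,\sigma^*,\mathbb{Z}^2)$ has only three invariant measures $\{\mu_\alpha,\mathbb{P}_+,\mathbb{P}_-\}$, up to a scaling factor. Moreover: (i) $\Omega_\alpha$ is homeomorphic to the two-point compactification of $\mathbb{Z}$ for $\alpha\in\mathbb{Q}\cup\{\pm\infty\}$; (ii) $\Omega_\alpha$ is a Cantor set for $\alpha$ irrational.
   Context: Fix $b_+,b_-\in\mathbb{R}$ with $b_+-b_-\notin 2\pi\mathbb{Z}$. For $\alpha\in\mathbb{R}$ let $B_\alpha:\mathbb{Z}^2\to\mathbb{R}$ be the Iwatsuka magnetic field $B_\alpha(n)=b_+$ if $-\alpha n_1+n_2>0$ and $B_\alpha(n)=b_-$ otherwise. For $\alpha=\pm\infty$ let $B_{\pm\infty}(n)=b_\mp$ if $n_1>0$ and $B_{\pm\infty}(n)=b_\pm$ otherwise. Put $f_\alpha(n)=e^{\mathrm{i}B_\alpha(n)}$. For $g\in\ell^\infty(\mathbb{Z}^2)$ and $\gamma\in\mathbb{Z}^2$ let $(\sigma_\gamma g)(n)=g(n-\gamma)$. Let $\mathfrak{F}_\alpha\subset\ell^\infty(\mathbb{Z}^2)$ be the (unital, commutative) $C^*$-algebra generated by $\{\sigma_\gamma(f_\alpha):\gamma\in\mathbb{Z}^2\}$. The magnetic hull $\Omega_\alpha$ is the Gelfand spectrum of $\mathfrak{F}_\alpha$, a compact metrizable space, with the $\mathbb{Z}^2$-action $\sigma^*_\gamma(\omega)(g)=\omega(\sigma_{-\gamma}(g))$.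 Sending $\omega\in\Omega_\alpha$ to the function $n\mapsto\omega(\sigma_{-n}(f_\alpha))$ identifies $\Omega_\alpha$ with a closed subset of the full shift space $\{e^{\mathrm{i}b_+},e^{\mathrm{i}b_-}\}^{\mathbb{Z}^2}$ (with the prodiscrete topology). Under this identification $\omega_\pm\in\Omega_\alpha$ denote the constant functions $\omega_\pm(n)=e^{\mathrm{i}b_\pm}$, which are fixed by $\sigma^*$. Put $\Omega_\alpha^\circ=\Omega_\alpha\setminus\{\omega_+,\omega_-\}$, an open invariant subset. The measures are as follows. $\mathbb{P}_\pm$ is the probability measure on $\Omega_\alpha$ with $\mathbb{P}_\pm(\{\omega_\pm\})=1$. The measure $\mu_\alpha$ is a regular Borel invariant measure supported in $\Omega_\alpha^\circ$: - if $\alpha=p/q$ with $p,q$ relatively prime and $q\geq 0$ ($\alpha=\pm\infty$ corresponding to $p=\pm1$, $q=0$), then $\mu_\alpha$ is $(p^2+q^2)^{-1/2}$ times the counting measure on the discrete countable set $\Omega_\alpha^\circ$; - if $\alpha$ is irrational, then for Borel $A\subset\Omega_\alpha^\circ$, $\mu_\alpha(A)$ is the Lebesgue measure of $\{x\in\mathbb{R}:\omega_x\in A\}$, where $\omega_x\in\Omega_\alpha^\circ$ is given by $\omega_x(n)=e^{\mathrm{i}b_+}$ if $-\alpha n_1+n_2-x>0$ and $\omega_x(n)=e^{\mathrm{i}b_-}$ otherwise (the set $\Omega_\alpha^\circ\setminus\{\omega_x\}_{x\in\mathbb{R}}$ is countable and null).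
   Formalization: Sums like P₊+P₋ refute ''only three''; the formal claim: among invariant Borel measures regular on Ω_α° and finite at ω_±, the ergodic ones are exactly the positive multiples of μ_α, P₊, P₋, and all are their nonnegative combinations. *)

(* Defs.v *)
From HB Require Import structures.
From mathcomp Require Import all_boot all_order all_algebra.
From mathcomp Require Import complex.
From mathcomp Require Import all_classical all_reals all_analysis.

Set Implicit Arguments.
Unset Strict Implicit.
Unset Printing Implicit Defensive.
Import Order.TTheory GRing.Theory Num.Theory.
Import numFieldNormedType.Exports.
Local Open Scope classical_set_scope.
Local Open Scope ring_scope.

Notation Z2 := (int * int)%type.

(* Typing R[i] as a numClosedFieldType gives it its modulus-norm topology. *)
Definition Cplx (R : realType) : numClosedFieldType := R[i].

Definition expi (R : realType) (t : R) : Cplx R := (cos t +i* sin t)%C.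

Definition shift (T : Type) (gamma : Z2) (g : Z2 -> T) : Z2 -> T :=
  fun n => g (n - gamma).

Definition ell_infty (R : realType) : set (Z2 -> Cplx R) :=
  [set g | exists M : Cplx R, forall n, `|g n| <= M].
Arguments ell_infty : clear implicits.

(* The algebra operations on [Z2 -> Cplx R] are pointwise; a set of bounded
   functions is sup-norm closed in [ell_infty] iff it is closed for uniform
   convergence. *)
Definition unital_cstar_subalgebra (R : realType)
    (S : set (Z2 -> Cplx R)) : Prop :=
  [/\ S `<=` ell_infty R,
      S 1,
      (forall (c : Cplx R) g h, S g -> S h -> S (c *: g + h)),
      (forall g h, S g -> S h -> S (g * h)) &
      (forall g, S g -> S (fun n => Num.conj (g n))) /\
      closed (S : set {uniform Z2 -> Cplx R})].

Definition homeomorphic (T U : topologicalType) : Prop :=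
  exists (f : T -> U) (g : U -> T),
    [/\ continuous f, continuous g, cancel f g & cancel g f].

(* Z with the two points -oo and +oo added, topologized inside [-oo, +oo]. *)
Definition two_point_compactification_Z (R : realType) : set (\bar R) :=
  [set x | [\/ x = -oo%E, x = +oo%E | exists k : int, x = (k%:~R)%:E]].

Arguments two_point_compactification_Z : clear implicits.

Section magnetic_hull.
Context {R : realType} (bp bm : R) (alpha : \bar R).

Definition iwatsuka (n : Z2) : R :=
  match alpha with
  | r%:E => if 0 < - r * n.1%:~R + n.2%:~R then bp else bm
  | +oo%E => if 0 < n.1 then bm else bp
  | -oo%E => if 0 < n.1 then bp else bm
  end.

Definition flux (n : Z2) : Cplx R := expi (iwatsuka n).

Definition hull_algebra : set (Z2 -> Cplx R) :=
  \bigcap_(S in [set S | unital_cstar_subalgebra S /\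
                         forall gamma, S (shift gamma flux)]) S.

Definition hull_pred : {pred Z2 -> Cplx R} := mem hull_algebra.

Lemma hull_subalg : subring_closed hull_pred /\ submod_closed hull_pred.
Proof.
have h1 : 1 \in hull_pred.
  by apply/mem_set => S [[_ S1 _ _ _] _].
have hL (c : Cplx R) g h : g \in hull_pred -> h \in hull_pred ->
    c *: g + h \in hull_pred.
  move=> /set_mem Fg /set_mem Fh; apply/mem_set => S HS.
  have [[S1 S2 S3 S4 S5] Sg] := HS.
  by apply: S3; [exact: (Fg S HS) | exact: (Fh S HS)].
split; split=> //.
- by move=> g h Fg Fh; rewrite addrC -scaleN1r; exact: hL.
- move=> g h /set_mem Fg /set_mem Fh; apply/mem_set => S HS.
  have [[S1 S2 S3 S4 S5] Sg] := HS.
  by apply: S4; [exact: (Fg S HS) | exact: (Fh S HS)].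
- by rewrite -(addNr 1) -scaleN1r; exact: hL.
Qed.

HB.instance Definition _ := GRing.isSubringClosed.Build _ hull_pred
  hull_subalg.1.
HB.instance Definition _ := GRing.isSubmodClosed.Build _ _ hull_pred
  (GRing.submod_closed_semi hull_subalg.2).

Record Falg := FAlg {
  fun_of_Falg :> Z2 -> Cplx R ;
  _ : fun_of_Falg \in hull_pred }.

HB.instance Definition _ := [isSub for fun_of_Falg].
HB.instance Definition _ := [Choice of Falg by <:].
HB.instance Definition _ :=
  GRing.SubChoice_isSubComPzRing.Build _ _ Falg hull_subalg.1.
HB.instance Definition _ := [SubZmodule_isSubLmodule of Falg by <:].

Lemma flux_in_Falg : flux \in hull_pred.
Proof.
apply/mem_set => S [_ /(_ 0)]; congr (S _).
by apply/funext => n; rewrite /shift subr0.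
Qed.

Definition flux_Falg : Falg := FAlg flux_in_Falg.

Lemma shift_in_Falg gamma (g : Falg) : shift gamma g \in hull_pred.
Proof.
case: g => g /= /set_mem Fg; apply/mem_set => S [[S1 S2 S3 S4 [S5 S6]] Sf].
apply: (Fg [set g | S (shift gamma g)]); split => /=; last first.
  move=> delta.
  have -> : shift gamma (shift delta flux) = shift (gamma + delta) flux.
    by apply/funext => n; rewrite /shift opprD addrA.
  exact: Sf.
split => //.
- move=> h /S1 [M hM]; exists M => n.
  by have := hM (n + gamma); rewrite /shift addrK.
- by move=> c h k; exact: S3.
- by move=> h k; exact: S4.
- split; first by move=> h; exact: S5.
  move=> h hcl; apply: S6 => U /uniform_nbhs [E [entE EU]].
  have /hcl [g0 [Sg Eg]] : nbhs (h : {uniform Z2 -> Cplx R})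
      [set k | forall n, setT n -> E (h n, k n)] by apply/uniform_nbhs; exists E; split.
  by exists (shift gamma g0); split=> //; apply: EU => n _; exact: Eg.
Qed.

Definition shift_Falg gamma (g : Falg) : Falg := FAlg (shift_in_Falg gamma g).

Definition is_character (chi : Falg -> Cplx R) : Prop :=
  [/\ scalar chi, {morph chi : g h / g * h} & exists g, chi g != 0].

(* Gelfand spectrum, with the weak-* topology (pointwise convergence on Falg). *)
Definition hull : Type :=
  [set chi : {ptws Falg -> Cplx R} | is_character chi].

HB.instance Definition _ := Topological.on hull.
HB.instance Definition _ := Choice.on hull.

Lemma eval0_character : is_character (fun g : Falg => g 0).
Proof. by split=> //; exists 1; rewrite oner_neq0. Qed.

HB.instance Definition _ := isPointed.Build hull
  (SigSub (mem_set eval0_character) : hull).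

Lemma sigma_star_character gamma (w : hull) :
  is_character (fun g => set_val w (shift_Falg (- gamma) g)).
Proof.
have := set_valP w; rewrite /=; case: w => chi /= chiP [chi1 chi2 [g chig]].
split.
- move=> c h k; rewrite -chi1; congr (chi _).
  exact/val_inj.
- move=> h k /=; rewrite -chi2; congr (chi _).
  exact/val_inj.
- exists (shift_Falg gamma g); congr (chi _ != 0): chig.
  by apply/val_inj/funext => n /=; rewrite /shift opprK addrK.
Qed.

Definition sigma_star gamma (w : hull) : hull :=
  SigSub (mem_set (sigma_star_character gamma w)).

(* The embedding of the hull in the full shift with alphabet
   {expi bp, expi bm}; the two fixed points and the points of [omega_line] are
   specified through their codes. *)
Definition hull_code (w : hull) : Z2 -> Cplx R :=
  fun n => set_val w (shift_Falg (- n) flux_Falg).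

Definition hull_interior : set hull :=
  [set w | hull_code w <> cst (expi bp) /\ hull_code w <> cst (expi bm)].

Definition hull_borel := g_sigma_algebraType (@open hull).

(* [slope p 0] is only meant for p = 1 and p = -1. *)
Definition slope (p q : int) : \bar R :=
  if q == 0 then if 0 < p then +oo%E else -oo%E
  else (p%:~R / q%:~R)%:E.

Definition omega_line (r x : R) : Z2 -> Cplx R :=
  fun n => if 0 < - r * n.1%:~R + n.2%:~R - x then expi bp else expi bm.

Definition is_mu_alpha (m : {measure set hull_borel -> \bar R}) : Prop :=
  (forall p q : int, coprimez p q -> 0 <= q -> alpha = slope p q ->
     forall A : set hull_borel, measurable A ->
       m A = (((Num.sqrt (p ^+ 2 + q ^+ 2)%:~R)^-1)%R%:E *
              counting (A `&` hull_interior))%E) /\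
  (forall r : R, irrational r -> alpha = r%:E ->
     forall A : set hull_borel, measurable A ->
       m A = lebesgue_measure
         [set x : R | exists2 w, (A `&` hull_interior) w &
                                 hull_code w = omega_line r x]).

Definition regular_on_interior (m : {measure set hull_borel -> \bar R}) : Prop :=
  [/\ forall K : set hull, compact K -> K `<=` hull_interior ->
        (m K < +oo)%E,
      forall A : set hull_borel, measurable A -> A `<=` hull_interior ->
        m A = ereal_inf [set m U | U in [set U : set hull |
                [/\ open U, A `<=` U & U `<=` hull_interior]]] &
      forall A : set hull_borel, measurable A -> A `<=` hull_interior ->
        m A = ereal_sup [set m K | K in [set K : set hull |
                compact K /\ K `<=` A]]].

(* [mu_alpha] is infinite near the two fixed points, so regularity is required
   on the open set [hull_interior] and finiteness at the two fixed points. *)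
Definition invariant_measure (m : {measure set hull_borel -> \bar R}) : Prop :=
  [/\ regular_on_interior m,
      (m (~` hull_interior) < +oo)%E &
      forall (gamma : Z2) (A : set hull_borel), measurable A ->
        m (sigma_star gamma @^-1` A) = m A].

Definition ergodic (m : {measure set hull_borel -> \bar R}) : Prop :=
  m setT != 0%E /\
  forall A : set hull_borel, measurable A ->
    (forall gamma, sigma_star gamma @^-1` A = A) ->
    m A = 0%E \/ m (~` A) = 0%E.

Definition proportional (m1 m2 : {measure set hull_borel -> \bar R}) : Prop :=
  exists2 c : R, 0 < c &
    forall A : set hull_borel, measurable A -> m1 A = (c%:E * m2 A)%E.

End magnetic_hull.

(* Main.v *)
Require Import Defs.
From HB Require Import structures.
From mathcomp Require Import all_boot all_order all_algebra.
From mathcomp Require Import complex.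
From mathcomp Require finmap.
From mathcomp Require Import all_classical all_reals all_analysis.
From mathcomp Require Import zify ring lra.
Import Order.TTheory GRing.Theory Num.Theory.
Import numFieldNormedType.Exports.
Local Open Scope classical_set_scope.
Local Open Scope ring_scope.

Set Implicit Arguments.
Unset Strict Implicit.
Unset Printing Implicit Defensive.

(** For every [alpha] the field jumps across a level line of an additive map
    [L : Z2 -> R], with [L n = n.2 - alpha * n.1] for finite [alpha] and
    [L n = - n.1] or [n.1] for [alpha = +oo] or [-oo].  The characters of the
    algebra are determined by their codes, and the codes are exactly the subsets
    of [Z2] that are upward closed for the preorder defined by [L]: two-point
    relations [(f_n - e^(i b_-)) (f_m - e^(i b_+)) = 0] give one inclusion,
    limits along ultrafilters the other.  The hull is thus the space of cuts of
    [L(Z2)]; it splits into the two constant codes and an open set exhausted by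
    the compact open sets [gap n m] of the cuts between [L n] and [L m].

    An invariant measure that is finite on the gaps satisfies
    [m (gap n m) = a (L m - L n)], because [m (gap 0 n)] is additive and monotone
    in [n]; as the gaps are closed under intersection and generate the Borel sets,
    the invariant measure on the interior is unique up to a factor.  Applied to
    the restriction of [mu] to an invariant set, this uniqueness also shows that
    [mu] is ergodic.

    The group [L(Z2)] is cyclic or dense.  If it is cyclic (rational slope) the cuts
    form the two-point compactification of [Z]; if it is dense the space of cuts has
    no isolated point and is a Cantor set. *)

(** The hull is defined by characters of a closed algebra, so injectivity of the code and its
    compatibility with the topology must both pass from the translates of [flux] to uniform limits
    of polynomials in them. This needs [|chi g|] to be at most the supremum of [|g|], which holds
    because a geometric series inverts [1 - u] inside the algebra when [u] is uniformly smaller than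
    1. Afterwards only the fields of [cut_coding] and the action of the shifts on codes matter, and
    slopes are treated alike until the cyclic and dense cases part. As [L] need not be injective,
    [cut_up] also forces equal codes at sites of equal level.

    Invariant measures may be infinite near the constant codes, so everything is measured inside
    gaps. Levels need not be divisible, hence linearity of the gap measure comes from an Archimedean
    comparison of integer multiples. Regularity is obtained by approximation inside one gap at a
    time and turns out to be equivalent to finiteness on gaps. *)

Record cut_coding {R : realType} (L : Z2 -> R) {T : topologicalType}
    (b : T -> Z2 -> bool) : Prop := CutCoding {
  cut_additive : {morph L : n m / n - m};
  cut_nontrivial : exists e, 0 < L e;
  cut_inj : injective b;
  cut_up : forall w n m, L n <= L m -> b w n -> b w m;
  cut_surj : forall x : Z2 -> bool,
    (forall n m, L n <= L m -> x n -> x m) -> exists w, b w = x;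
  cut_nbhs : forall w (U : set T), nbhs w U <->
    exists s : seq Z2, forall w', {in s, b w' =1 b w} -> U w' }.

Definition slope_form {R : realType} (alpha : \bar R) (n : Z2) : R :=
  match alpha with
  | r%:E => n.2%:~R - r * n.1%:~R
  | +oo%E => - n.1%:~R
  | -oo%E => n.1%:~R
  end.

(* For [alpha = +oo] the field jumps between [n.1 = 0] and [n.1 = 1], on the
   other side of the line [n.1 = 0] than for the other slopes. *)
Definition jump_site {R : realType} (alpha : \bar R) : Z2 :=
  if alpha is +oo%E then (1, 0) else (0, 0).

Lemma slope_formB {R : realType} (alpha : \bar R) :
  {morph slope_form alpha : n m / n - m}.
Proof.
move=> [n1 n2] [m1 m2]; rewrite /slope_form; case: alpha => [r| |] /=;
  rewrite !rmorphB /=; ring.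
Qed.

Lemma slope_formD {R : realType} (alpha : \bar R) :
  {morph slope_form alpha : n m / n + m}.
Proof.
move=> n m; have -> : n + m = n - (0 - m) by rewrite sub0r opprK.
by rewrite !slope_formB opprB addrA addrAC -slope_formB subr0.
Qed.

Lemma slope_form_nontrivial {R : realType} (alpha : \bar R) :
  exists e, 0 < slope_form alpha e.
Proof.
case: alpha => [r| |] /=.
- by exists (0, 1); rewrite /= mulr0 subr0 ltr01.
- by exists (-1, 0); rewrite /= rmorphN opprK ltr01.
- by exists (1, 0); rewrite /= ltr01.
Qed.

Lemma iwatsukaE {R : realType} (bp bm : R) alpha n :
  iwatsuka bp bm alpha n =
  if 0 < slope_form alpha (n - jump_site alpha) then bp else bm.
Proof.
case: n => n1 n2; case: alpha => [r| |]; rewrite /iwatsuka /=.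
- by rewrite !subr0 addrC mulNr.
- rewrite rmorphB /= oppr_gt0 subr_lt0.
  rewrite -[1]/(1%:~R) ltr_int; case: ltP => h1; case: ltP => h2 //; lia.
- by rewrite subr0 ltr0z.
Qed.

(** The remainder [s] of [a - b] modulo [2 * pi] has cosine 1, so [sin (s / 2) = 0] by the double
    angle formula; but the sine is positive strictly between 0 and [pi]. *)
Lemma eq_cos_sin {R : realType} (a b : R) :
  cos a = cos b -> sin a = sin b -> exists k : int, a - b = k%:~R * (2 * pi).
Proof.
move=> ec es; set k := Num.floor ((a - b) / (2 * pi)).
have tpi : 0 < 2 * pi :> R by rewrite mulr_gt0 ?pi_gt0.
exists k; set s := a - b - k%:~R * (2 * pi).
suff : s = 0 by rewrite /s; lra.
have cs : cos s = 1.
  have cperiod (j : nat) x : cos (x + j%:R * (2 * pi)) = cos x :> R.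
    have -> : j%:R * (2 * pi) = (pi *+ 2) *+ j :> R by rewrite !mulr_natl.
    exact: (periodicn (@cosD2pi R)).
  have -> : cos s = cos (a - b).
    rewrite /s; case: (k) => j.
      by rewrite -(cperiod j (_ - _)) subrK.
    by rewrite NegzE rmorphN mulNr opprK cperiod.
  by rewrite cosB ec es -!expr2 cos2Dsin2.
have s0 : 0 <= s.
  rewrite /s subr_ge0 -ler_pdivlMr //; exact: floor_le.
have s1 : s < 2 * pi.
  have := floorD1_gt ((a - b) / (2 * pi)).
  by rewrite ltr_pdivrMr // -/k intrD /s; lra.
apply/eqP; rewrite eq_le s0 andbT leNgt; apply/negP => sp.
have : 0 < sin (s / 2) by apply: sin_gt0_pi; apply/andP; split; lra.
move: cs; rewrite {1}(_ : s = (s / 2) *+ 2); last by rewrite mulr2n; lra.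
by rewrite cos_mulr2n cos2sin2 => h1 h2; nra.
Qed.

(** * The algebra of the flux function *)

Section hull_coding.
Context {R : realType} (bp bm : R) (alpha : \bar R).
Context (hb : forall k : int, bp - bm <> k%:~R * (2 * pi)).

Notation hull := (hull bp bm alpha).
Notation Falg := (Falg bp bm alpha).
Notation up := (expi bp).
Notation um := (expi bm).
Notation F := (hull_algebra bp bm alpha).
Notation L := (slope_form alpha).

(** The hypothesis [hb] acts only through this separation of the two values. *)
Lemma expi_neq : up != um.
Proof.
apply/eqP => -[c s]; have [k /hb] := eq_cos_sin c s; exact.
Qed.

Definition bflux (n : Z2) : bool := 0 < L (n - jump_site alpha).

Lemma fluxE n : flux bp bm alpha n = if bflux n then up else um.
Proof. by rewrite /flux iwatsukaE /bflux; case: ifP. Qed.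

Lemma bflux_up n m : L n <= L m -> bflux n -> bflux m.
Proof.
by rewrite /bflux !slope_formB => h1 h2; apply: lt_le_trans h2 _; rewrite lerD2r.
Qed.

Lemma norm_expi (t : R) : `|expi t| = 1.
Proof. by rewrite normc_def /= cos2Dsin2 sqrtr1. Qed.

Lemma ent_Cplx (e : R) : 0 < e ->
  entourage [set xy : Cplx R * Cplx R | `|xy.1 - xy.2| < (e%:C)%C :> Cplx R].
Proof.
move=> e0; rewrite -entourage_from_ballE; exists (e%:C)%C; first by rewrite /= ltcR.
by move=> [x y] /=; rewrite -ball_normE.
Qed.

(** Balls of [R[i]] have radii in [R[i]]; a positive radius is real, so real tolerances suffice. *)
Lemma ent_CplxE (E : set (Cplx R * Cplx R)) : entourage E ->
  exists2 e : R, 0 < e & forall x y, `|x - y| < (e%:C)%C :> Cplx R -> E (x, y).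
Proof.
rewrite -entourage_from_ballE => -[e /= e0 eE].
have : e \is Num.real by rewrite realE (ltW e0).
move=> /complex_realP [k ek]; exists k; first by rewrite -ltcR -ek.
by move=> x y xy; apply: eE => /=; rewrite -ball_normE /= ek.
Qed.

Lemma closed_uniformP (S : set (Z2 -> Cplx R)) :
  closed (S : set {uniform Z2 -> Cplx R}) <->
  forall g, (forall e : R, 0 < e -> exists2 h, S h &
     forall n, `|g n - h n| < (e%:C)%C :> Cplx R) -> S g.
Proof.
split=> cS g gS; apply: cS.
  move=> U /uniform_nbhs [E [entE EU]].
  have [e e0 eE] := ent_CplxE entE.
  have [h Sh gh] := gS e e0; exists h; split=> //; apply: EU => n _.
  exact: eE.
move=> e e0.
have /gS [h [Sh gh]] : nbhs (g : {uniform Z2 -> Cplx R})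
    [set k | forall n, setT n -> `|g n - k n| < (e%:C)%C :> Cplx R].
  by apply/uniform_nbhs; eexists; split; [exact: ent_Cplx e0|].
by exists h => // n; apply: gh.
Qed.

Lemma ell_infty_cstar : unital_cstar_subalgebra (ell_infty R).
Proof.
split=> //.
- by exists 1 => n; rewrite normr1.
- move=> c g h [M gM] [N hN]; exists (`|c| * M + N) => n.
  apply: le_trans (ler_normD _ _) _; apply: lerD => //.
  by rewrite normrM ler_wpM2l.
- move=> g h [M gM] [N hN]; exists (M * N) => n.
  by rewrite normrM ler_pM.
- split; first by move=> g [M gM]; exists M => n; rewrite norm_conjC.
  apply/closed_uniformP => g /(_ 1 ltr01) [h [M hM] gh].
  exists (1 + M) => n; rewrite -(subrK (h n) (g n)).
  by apply: le_trans (ler_normD _ _) _; apply: lerD => //; exact/ltW/gh.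
Qed.

Lemma hull_algebra_cstar : unital_cstar_subalgebra F.
Proof.
split.
- move=> g /(_ _ (conj ell_infty_cstar _)); apply=> gamma.
  by exists 1 => n; rewrite /Defs.shift /flux norm_expi.
- by move=> S [[]].
- by move=> c g h Fg Fh S FS; case: (FS) => -[_ _ + _ _] _; apply; [exact: Fg|exact: Fh].
- by move=> g h Fg Fh S FS; case: (FS) => -[_ _ _ + _] _; apply; [exact: Fg|exact: Fh].
- split.
    by move=> g Fg S FS; case: (FS) => -[_ _ _ _ [+ _]] _; apply; exact: Fg.
  apply/closed_uniformP => g gF S FS; case: (FS) => -[_ _ _ _ [_ +]] _.
  move/closed_uniformP; apply=> e /gF [h Fh gh]; exists h => //; exact: Fh.
Qed.

(* A property of the elements of the algebra need not be checked on conjugates: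
   the conjugate of the two-valued function [flux] is an affine function of it. *)
Lemma Falg_ind (P : Falg -> Prop) :
  P 1 -> (forall c g h, P g -> P h -> P (c *: g + h)) ->
  (forall g h, P g -> P h -> P (g * h)) ->
  (forall g : Falg, (forall e : R, 0 < e -> exists2 h : Falg, P h &
     forall n, `|g n - h n| < (e%:C)%C :> Cplx R) -> P g) ->
  (forall gamma, P (shift_Falg gamma (flux_Falg bp bm alpha))) ->
  forall g, P g.
Proof.
move=> P1 PL PM PC PS.
(* Asking [P] of a function and of its conjugate makes [S] closed under conjugation by
   construction. *)
pose S := [set h : Z2 -> Cplx R | exists g g' : Falg,
  [/\ g = h :> (Z2 -> _), g' = (fun n => Num.conj (h n)) :> (Z2 -> _), P g & P g']].
have [F1 F2 F3 F4 [F5 F6]] := hull_algebra_cstar.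
have FF (g : Falg) : F g by case: g => g /= /set_mem.
have SS : unital_cstar_subalgebra S.
  split.
  - by move=> h [g [_ [<- _ _ _]]]; exact: F1.
  - exists 1, 1; split=> //; apply/funext => n.
    by rewrite [RHS](_ : _ = Num.conj 1) // rmorph1.
  - move=> c _ _ [g [g' [<- eg' Pg Pg']]] [h [h' [<- eh' Ph Ph']]].
    exists (c *: g + h), (Num.conj c *: g' + h'); split=> //.
    + apply/funext => n /=; rewrite [RHS](_ : _ = Num.conj (c * g n + h n)) //.
      rewrite rmorphD rmorphM.
      by have := congr1 (@^~ n) eg'; have := congr1 (@^~ n) eh' => /= <- <-.
    + exact: PL.
    + exact: PL.
  - move=> _ _ [g [g' [<- eg' Pg Pg']]] [h [h' [<- eh' Ph Ph']]].
    exists (g * h), (g' * h'); split=> //.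
    + apply/funext => n /=; rewrite [RHS](_ : _ = Num.conj (g n * h n)) //.
      rewrite rmorphM.
      by have := congr1 (@^~ n) eg'; have := congr1 (@^~ n) eh' => /= <- <-.
    + exact: PM.
    + exact: PM.
  split.
    move=> _ [g [g' [<- eg' Pg Pg']]]; exists g', g; split=> //.
    by apply/funext => n; rewrite conjCK.
  apply/closed_uniformP => g gS.
  have Fg : F g.
    move/closed_uniformP: F6; apply=> e /gS [h [k [_ [<- _ _ _]]] gh].
    by exists k.
  exists (FAlg (mem_set Fg)), (FAlg (mem_set (F5 _ Fg))); split=> //.
    by apply: PC => e /gS [h [k [_ [<- _ Pk _]]] gh]; exists k.
  apply: PC => e /gS [h [_ [k [_ ek _ Pk]]] gh]; exists k => //= n.
  by rewrite ek -rmorphB norm_conjC.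
suff SF gamma : S (Defs.shift gamma (flux bp bm alpha)).
  move=> g; have [k [_ [kg _ Pk _]]] := FF g S (conj SS SF).
  by have <- : k = g by exact: val_inj.
(* The affine map [z -> a z + b] is the one sending [up] and [um] to their conjugates. *)
pose a := (Num.conj up - Num.conj um) / (up - um).
pose b := Num.conj um - a * um.
exists (shift_Falg gamma (flux_Falg bp bm alpha)),
  (a *: shift_Falg gamma (flux_Falg bp bm alpha) + (b *: (1 : Falg) + 0)).
split=> //.
- apply/funext => n; rewrite [LHS](_ : _ = a * flux bp bm alpha (n - gamma) + (b * 1 + 0)) //.
  rewrite /Defs.shift fluxE /b /a mulr1 addr0; case: bflux; last by rewrite addrC subrK.
  rewrite addrC addrAC -addrA -mulrBr divfK ?subr_eq0 ?expi_neq //.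
  by rewrite addrC subrK.
- apply: (PL) => //; apply: (PL) => //.
  by rewrite -(addNr 1) -scaleN1r; exact: PL.
Qed.

End hull_coding.

(** * Characters and the supremum norm *)

Section characters.
Context {R : realType} (bp bm : R) (alpha : \bar R).

Notation Falg := (Falg bp bm alpha).
Notation F := (hull_algebra bp bm alpha).

Section one_character.
Context (chi : Falg -> Cplx R) (chiP : is_character chi).

Lemma charD g h : chi (g + h) = chi g + chi h.
Proof. by case: chiP => + _ _ => /(_ 1 g h); rewrite scale1r mul1r. Qed.

Lemma char0 : chi 0 = 0.
Proof. by apply: (addrI (chi 0)); rewrite -charD !addr0. Qed.

Lemma charZ c g : chi (c *: g) = c * chi g.
Proof. by case: chiP => + _ _ => /(_ c g 0); rewrite char0 !addr0. Qed.

Lemma charB g h : chi (g - h) = chi g - chi h.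
Proof. by rewrite -scaleN1r charD charZ mulN1r. Qed.

Lemma charM g h : chi (g * h) = chi g * chi h.
Proof. by case: chiP => _ /(_ g h). Qed.

Lemma char1 : chi 1 = 1.
Proof.
case: (chiP) => _ _ [g g0]; apply: (mulIf g0).
by rewrite -charM !mul1r.
Qed.

(** The partial sums of the geometric series of [u] lie in the algebra and converge uniformly to the
    pointwise inverse, because [|1 - u|] stays above [1 - q]; the algebra is closed. *)
Lemma geometric_inverse (u : Falg) (q : R) : q < 1 ->
  (forall n, `|u n| <= (q%:C)%C :> Cplx R) ->
  exists h : Falg, (1 - u) * h = 1.
Proof.
move=> q1 uq.
have q0 : 0 <= q by rewrite -ler0c; exact: le_trans (normr_ge0 _) (uq 0).
have u1 n : 1 - (q%:C)%C <= `|1 - u n| :> Cplx R.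
  apply: le_trans (_ : 1 - `|u n| <= _); first exact: lerB.
  by have := lerB_dist 1 (u n); rewrite normr1.
have q1C : 0 < 1 - (q%:C)%C :> Cplx R by rewrite subr_gt0 -(rmorph1 (real_complex R)) ltcR.
have un0 n : 1 - u n != 0 by rewrite -normr_gt0; apply: lt_le_trans (u1 n).
have [_ _ _ _ [_ /closed_uniformP FC]] := hull_algebra_cstar bp bm alpha.
have partial K : exists p : Falg, forall n, (1 - u n) * p n = 1 - u n ^+ K.
  elim: K => [|K [p pE]].
    by exists 0 => n; rewrite mulr0 expr0 subrr.
  exists (1 + u * p) => n.
  rewrite [X in _ * X](_ : _ = 1 + u n * p n) // mulrDr mulrCA pE exprS.
  by ring.
have Fh : F (fun n => (1 - u n)^-1).
  apply: FC => e e0.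
  have : (fun K => q ^+ K) @ \oo --> (0 : R).
    by apply: cvg_expr; rewrite ger0_norm.
  (* The error of the partial sum is [u ^+ K / (1 - u)]; the factor [1 - q] in the tolerance absorbs
     this division. *)
  move=> /cvgrPdist_lt /(_ (e * (1 - q))) []; first by rewrite mulr_gt0 // subr_gt0.
  move=> K _ /(_ K (leqnn K)) /=; rewrite sub0r normrN ger0_norm ?exprn_ge0 // => qK.
  have [p pE] := partial K; exists p; first by case: p {pE} => p /= /set_mem.
  move=> n.
  have -> : (1 - u n)^-1 - p n = u n ^+ K / (1 - u n).
    apply: (mulfI (un0 n)); rewrite mulrBr pE divff // mulrCA divff //.
    by rewrite mulr1 subKr.
  rewrite normrM normfV normrX ltr_pdivrMr ?normr_gt0 //.
  apply: le_lt_trans (_ : ((q ^+ K)%:C)%C < _).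
    by rewrite rmorphXn /= lerXn2r ?nnegrE // lecR.
  apply: lt_le_trans (_ : ((e * (1 - q))%:C)%C <= _); first by rewrite ltcR.
  rewrite [X in X <= _](_ : _ = (e%:C)%C * (1 - (q%:C)%C)).
    by rewrite ler_wpM2l ?ler0c ?(ltW e0).
  by rewrite (rmorphM (real_complex R)) (rmorphB (real_complex R)) rmorph1.
exists (FAlg (mem_set Fh)); apply/val_inj/funext => n.
by rewrite [LHS](_ : _ = (1 - u n) / (1 - u n)) // divff.
Qed.

(** If [|chi g|] exceeded [e], then [1 - g / chi g] would be invertible by the geometric series,
    although [chi] sends it to 0. *)
Lemma char_bound (g : Falg) (e : R) :
  (forall n, `|g n| <= (e%:C)%C :> Cplx R) -> `|chi g| <= (e%:C)%C.
Proof.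
move=> ge.
have e0 : 0 <= e by rewrite -ler0c; exact: le_trans (normr_ge0 _) (ge 0).
have /complex_realP [k kE] : `|chi g| \is Num.real by [].
rewrite kE lecR leNgt; apply/negP => ek.
have k0 : 0 < k by apply: le_lt_trans ek.
have c0 : chi g != 0 by rewrite -normr_gt0 kE ltcR.
have [||h hE] := @geometric_inverse ((chi g)^-1 *: g) (e / k).
- by rewrite ltr_pdivrMr // mul1r.
- move=> n; rewrite [X in `|X|](_ : _ = (chi g)^-1 * g n) //.
  rewrite normrM normfV kE mulrC rmorphM /= fmorphV.
  by rewrite ler_wpM2r // invr_ge0 lecR ltW.
have := congr1 chi hE; rewrite charM charB charZ char1 mulVf // subrr mul0r.
by move/eqP; rewrite eq_sym oner_eq0.
Qed.

End one_character.
End characters.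

(** * The hull as the space of upward closed sets *)

Lemma fmap_ultra {T U : Type} (f : T -> U) (G : set_system T) :
  UltraFilter G -> UltraFilter (f @ G).
Proof.
move=> GU; split=> [|H HP GH]; first exact: fmap_proper_filter.
apply/seteqP; split=> // A HA; have [//|GnA] := in_ultra_setVsetC (f @^-1` A) GU.
have /GH HnA : (f @ G) (~` A) by [].
by have [x []] := filter_ex (filterI HA HnA).
Qed.

Lemma bounded_ultra_cvg {R : realType} {T : Type} (G : set_system T) (f : T -> R) (M : R) :
  UltraFilter G -> (forall t, `|f t| <= M) -> f @ G --> lim (f @ G).
Proof.
move=> GU fM; have := @segment_compact R (- M) M; rewrite compact_ultra.
move=> /(_ _ (fmap_ultra f GU)) [|l [_ fl]].
  suff : G (f @^-1` [set` `[- M, M]]) by [].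
  by apply: filterE => t /=; rewrite in_itv /= -ler_norml.
by move: fl => /= /cvgP.
Qed.

Lemma seq_argmax {R : realType} {T : eqType} (f : T -> R) (P : pred T) (s : seq T) :
  has P s -> exists2 z, z \in s /\ P z & {in s, forall n, P n -> f n <= f z}.
Proof.
elim: s => //= a s IH; case Ps : (has P s).
  move=> _; have [z [zs Pz] zmax] := IH Ps.
  case: (boolP (P a && (f z <= f a))) => [/andP[Pa za]|naz].
    exists a; first by rewrite mem_head.
    move=> n; rewrite inE => /predU1P[-> //|ns Pn].
    by apply: le_trans za; exact: zmax.
  exists z; first by rewrite inE zs orbT.
  move=> n; rewrite inE => /predU1P[-> Pa|ns Pn]; last exact: zmax.
  by move: naz; rewrite Pa /= -ltNge; exact: ltW.
rewrite orbF => Pa; exists a; first by rewrite mem_head.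
move=> n; rewrite inE => /predU1P[-> //|ns Pn].
by case/hasP: Ps; exists n.
Qed.

Lemma seq_argmin {R : realType} {T : eqType} (f : T -> R) (P : pred T) (s : seq T) :
  has P s -> exists2 z, z \in s /\ P z & {in s, forall n, P n -> f z <= f n}.
Proof.
move=> /(seq_argmax (fun n => - f n)) [z zP zmax]; exists z => // n ns Pn.
by rewrite -lerN2; exact: zmax.
Qed.

Section hull_coding.
Context {R : realType} (bp bm : R) (alpha : \bar R).
Context (hb : forall k : int, bp - bm <> k%:~R * (2 * pi)).

Notation hull := (hull bp bm alpha).
Notation Falg := (Falg bp bm alpha).
Notation up := (expi bp).
Notation um := (expi bm).
Notation F := (hull_algebra bp bm alpha).
Notation L := (slope_form alpha).
Notation bflux := (bflux alpha).

Definition hcode (w : hull) (n : Z2) : bool := hull_code w n == up.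

Definition moved_flux (n : Z2) : Falg :=
  shift_Falg (- n) (flux_Falg bp bm alpha).

Lemma moved_fluxE n k : moved_flux n k = if bflux (k + n) then up else um.
Proof. by rewrite -fluxE /= /Defs.shift opprK. Qed.

Lemma hull_val_character (w : hull) : is_character (set_val w).
Proof. exact: set_valP. Qed.

(** [moved_flux n] is a root of [(z - up) (z - um)], and a character turns this into the same
    equation for the number [hull_code w n]. *)
Lemma hull_code_hcode w n : hull_code w n = if hcode w n then up else um.
Proof.
rewrite /hcode; case: eqP => // /eqP wn.
have : (moved_flux n - up *: (1 : Falg)) * (moved_flux n - um *: (1 : Falg)) = 0.
  apply/val_inj/funext => k.
  rewrite [LHS](_ : _ = (moved_flux n k - up * 1) * (moved_flux n k - um * 1)) //.
  by rewrite moved_fluxE !mulr1; case: ifP; rewrite !subrr ?mul0r ?mulr0.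
move/(congr1 (set_val w)); have wP := hull_val_character w.
rewrite (charM wP) !(charB wP) !(charZ wP) (char1 wP) (char0 wP) !mulr1 => /eqP.
by rewrite mulf_eq0 !subr_eq0 (negbTE wn) /= => /eqP.
Qed.

Lemma hcode_up w n m : L n <= L m -> hcode w n -> hcode w m.
Proof.
move=> Lnm wn; apply: contraT => wm.
(* At each [k], either [k + n] lies below the jump and the first factor vanishes, or [k + m], whose
   level is no lower, lies above it and the second one does. *)
have : (moved_flux n - um *: (1 : Falg)) * (moved_flux m - up *: (1 : Falg)) = 0.
  apply/val_inj/funext => k.
  rewrite [LHS](_ : _ = (moved_flux n k - um * 1) * (moved_flux m k - up * 1)) //.
  rewrite !moved_fluxE !mulr1.
  have : L (k + n) <= L (k + m).
    by rewrite !slope_formD lerD2l.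
  move/(bflux_up); case: (bflux (k + n)) => [/(_ isT) ->|_].
    by rewrite subrr mulr0.
  by rewrite subrr mul0r.
move/(congr1 (set_val w)); have wP := hull_val_character w.
rewrite (charM wP) !(charB wP) !(charZ wP) (char1 wP) (char0 wP) !mulr1.
rewrite -/(hull_code w n) -/(hull_code w m) !hull_code_hcode wn (negbTE wm) => /eqP.
by rewrite mulf_eq0 !subr_eq0 (negbTE (expi_neq hb)) eq_sym (negbTE (expi_neq hb)).
Qed.

Lemma hcode_sigma_star gamma (w : hull) n :
  hcode (sigma_star gamma w) n = hcode w (n + gamma).
Proof.
rewrite /hcode; congr (_ == _); rewrite /hull_code /=; congr (set_val w _).
by apply/val_inj/funext => k; rewrite /= /Defs.shift !opprK addrAC addrA.
Qed.

Lemma shift_FalgE gamma : shift_Falg gamma (flux_Falg bp bm alpha) = moved_flux (- gamma).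
Proof. by rewrite /moved_flux opprK. Qed.

Lemma hcode_inj : injective hcode.
Proof.
move=> w w' ww'; apply/val_inj; apply/funext => g.
have wP := hull_val_character w; have wP' := hull_val_character w'.
rewrite -[LHS]/(set_val w g) -[RHS]/(set_val w' g).
move: g; apply: (Falg_ind hb).
- by rewrite (char1 wP) (char1 wP').
- by move=> c g h eg eh; rewrite !(charD wP) !(charD wP') !(charZ wP) !(charZ wP') eg eh.
- by move=> g h eg eh; rewrite !(charM wP) !(charM wP') eg eh.
- move=> g happ; apply/eqP; rewrite -subr_eq0 -normr_le0.
  have /complex_realP [k kE] : `|set_val w g - set_val w' g| \is Num.real by [].
  rewrite kE -(rmorph0 (real_complex R)) lecR; apply/ler_addgt0Pr => e e0.
  have [h wh gh] := happ (e / 2) (divr_gt0 e0 (ltr0n _ 2)).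
  rewrite -lecR -kE add0r.
  (* Since [w] and [w'] agree on [h], only the error [g - h] remains, and [char_bound] gives at most
     [e / 2] for each character. *)
  have -> : set_val w g - set_val w' g = set_val w (g - h) - set_val w' (g - h).
    by rewrite (charB wP) (charB wP') wh opprB addrA subrK.
  apply: le_trans (ler_normB _ _) _.
  rewrite [e in leRHS](splitr e) rmorphD; apply: lerD; apply: char_bound => // n;
    exact/ltW/gh.
- move=> gamma; rewrite shift_FalgE.
  rewrite -[LHS]/(hull_code w (- gamma)) -[RHS]/(hull_code w' (- gamma)).
  by rewrite !hull_code_hcode ww'.
Qed.

(** On a finite window an upward closed set looks like a translated half plane, with the threshold
    at the highest site of the window outside it. Translates of the flux thus approximate every
    admissible code. *)
Lemma bflux_window (x : Z2 -> bool) (s : seq Z2) :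
  (forall n m, L n <= L m -> x n -> x m) ->
  exists k, {in s, forall n, bflux (n + k) = x n}.
Proof.
move=> xup.
suff [z zP] : exists z, {in s, forall n, (L z < L n) = x n}.
  exists (jump_site alpha - z) => n /zP <-.
  by rewrite /bflux addrA addrAC addrK slope_formB subr_gt0.
have [xs|nxs] := boolP (has (predC x) s).
  have [z [zs /= nxz] zmax] := seq_argmax L xs.
  exists z => n ns; apply/idP/idP => [zn|xn].
    by apply: contraT => /(zmax _ ns); rewrite leNgt zn.
  by rewrite ltNge; apply: contra nxz => nz; exact: xup nz xn.
have xs : {in s, forall n, x n}.
  by move=> n ns; move: nxs; rewrite -all_predC => /allP /(_ n ns) /=; rewrite negbK.
(* With no site of the window outside [x], the threshold is put below the lowest site; [e] makes the
   inequality strict. *)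
have [e e0] := slope_form_nontrivial alpha.
case: s xs {nxs} => [|a s] xs; first by exists 0.
have [z _ zmin] := @seq_argmin R _ L predT (a :: s) isT.
exists (z - e) => n ns; rewrite (xs _ ns); apply: lt_le_trans (zmin _ ns isT).
by rewrite slope_formB gtrBl.
Qed.

End hull_coding.

(** * Realization of codes and the topology of the hull *)

Lemma cvg_ptws {I : Type} {V : topologicalType} (F : set_system (I -> V)) (f : I -> V) :
  Filter F -> (forall i, (fun g => g i) @ F --> f i) -> {ptws, F --> f}.
Proof.
move=> FF Ff; apply/cvg_sup => i A /=; rewrite (@nbhsE (initial_topology _)).
move=> [B [[W oW <-] Wf] BA]; apply: filterS BA _.
by apply: Ff; exact: open_nbhs_nbhs.
Qed.

Lemma ptws_near {I : eqType} {V : topologicalType} (f : {ptws I -> V}) (i : I)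
    (A : set V) : nbhs (f i) A -> nbhs f [set g : I -> V | A (g i)].
Proof. exact: (@proj_continuous I (fun=> V) i f A). Qed.

Lemma near_norm_lt {K : numClosedFieldType} (x e : K) :
  0 < e -> nbhs x [set y | `|x - y| < e].
Proof. by move=> e0; apply/nbhs_ballP; exists e => //; rewrite -ball_normE. Qed.

Section hull_topology.
Context {R : realType} (bp bm : R) (alpha : \bar R).
Context (hb : forall k : int, bp - bm <> k%:~R * (2 * pi)).

Notation hull := (hull bp bm alpha).
Notation Falg := (Falg bp bm alpha).
Notation up := (expi bp).
Notation um := (expi bm).
Notation L := (slope_form alpha).
Notation bflux := (bflux alpha).
Notation hcode := (@hcode R bp bm alpha).
Notation moved_flux := (moved_flux bp bm alpha).

Lemma Falg_bounded (g : Falg) : exists M : R, forall n, `|g n| <= (M%:C)%C :> Cplx R.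
Proof.
have [/(_ g) + _ _ _ _] := hull_algebra_cstar bp bm alpha.
move=> [|M gM]; first by case: g => g /= /set_mem.
have M0 : 0 <= M by exact: le_trans (normr_ge0 _) (gM 0).
have /complex_realP [k kE] : M \is Num.real by rewrite realE M0.
by exists k; rewrite -kE.
Qed.

Lemma norm_Re_le (z : Cplx R) (M : R) : `|z| <= (M%:C)%C -> `|complex.Re z| <= M.
Proof. by move=> zM; rewrite -lecR; exact: le_trans (normc_ge_Re z) zM. Qed.

Lemma norm_Im_le (z : Cplx R) (M : R) : `|z| <= (M%:C)%C -> `|complex.Im z| <= M.
Proof.
move=> zM; rewrite -normrN -ReiNIm; apply: norm_Re_le.
by rewrite normrM complexiE normCi mulr1.
Qed.

Section limit_character.
Context (G : set_system Z2) (GU : UltraFilter G).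

(** The limit of [g] along [G], taken coordinatewise: bounded real functions converge along an
    ultrafilter by compactness of segments. *)
Definition limit_char (g : Falg) : Cplx R :=
  (lim ((fun n => complex.Re (g n)) @ G) +i* lim ((fun n => complex.Im (g n)) @ G))%C.

Lemma cvg_Re (g : Falg) :
  (fun n => complex.Re (g n)) @ G --> complex.Re (limit_char g).
Proof.
have [M gM] := Falg_bounded g.
by apply: bounded_ultra_cvg => n; exact: norm_Re_le (gM n).
Qed.

Lemma cvg_Im (g : Falg) :
  (fun n => complex.Im (g n)) @ G --> complex.Im (limit_char g).
Proof.
have [M gM] := Falg_bounded g.
by apply: bounded_ultra_cvg => n; exact: norm_Im_le (gM n).
Qed.

Lemma limit_charE (g : Falg) (a b : R) :
  (fun n => complex.Re (g n)) @ G --> a -> (fun n => complex.Im (g n)) @ G --> b ->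
  limit_char g = (a +i* b)%C.
Proof.
by move=> /cvg_lim ga /cvg_lim gb; rewrite /limit_char ga // gb.
Qed.

Lemma limit_char_near (g : Falg) (c : Cplx R) : G [set n | g n = c] -> limit_char g = c.
Proof.
move=> gc; rewrite [RHS](_ : c = (complex.Re c +i* complex.Im c)%C); last by case: (c).
by apply: limit_charE; apply: cvg_near_cst; apply: filterS gc => n /= ->.
Qed.

Lemma limit_char_character : is_character limit_char.
Proof.
split.
- move=> c g h.
  have -> : c * limit_char g + limit_char h =
    ((complex.Re c * complex.Re (limit_char g) - complex.Im c * complex.Im (limit_char g)
       + complex.Re (limit_char h))
     +i* (complex.Re c * complex.Im (limit_char g) + complex.Im c * complex.Re (limit_char g)
       + complex.Im (limit_char h)))%C.
    by case: c (limit_char g) (limit_char h) => [c1 c2] [g1 g2] [h1 h2].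
  apply: limit_charE.
    rewrite [X in X @ G --> _](_ : _ = fun n =>
      complex.Re c * complex.Re (g n) - complex.Im c * complex.Im (g n) + complex.Re (h n)).
      apply: cvgD; last exact: cvg_Re; apply: cvgB.
        by apply: cvgM; [exact: cvg_cst|exact: cvg_Re].
      by apply: cvgM; [exact: cvg_cst|exact: cvg_Im].
    apply/funext => n; rewrite [X in complex.Re X](_ : _ = c * g n + h n) //.
    by case: c (g n) (h n) => [c1 c2] [g1 g2] [h1 h2].
  rewrite [X in X @ G --> _](_ : _ = fun n =>
      complex.Re c * complex.Im (g n) + complex.Im c * complex.Re (g n) + complex.Im (h n)).
    apply: cvgD; last exact: cvg_Im; apply: cvgD.
      by apply: cvgM; [exact: cvg_cst|exact: cvg_Im].
    by apply: cvgM; [exact: cvg_cst|exact: cvg_Re].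
  apply/funext => n; rewrite [X in complex.Im X](_ : _ = c * g n + h n) //.
  by case: c (g n) (h n) => [c1 c2] [g1 g2] [h1 h2].
- move=> g h.
  have -> : limit_char g * limit_char h =
    ((complex.Re (limit_char g) * complex.Re (limit_char h)
       - complex.Im (limit_char g) * complex.Im (limit_char h))
     +i* (complex.Re (limit_char g) * complex.Im (limit_char h)
       + complex.Im (limit_char g) * complex.Re (limit_char h)))%C.
    by case: (limit_char g) (limit_char h) => [g1 g2] [h1 h2].
  apply: limit_charE.
    rewrite [X in X @ G --> _](_ : _ = fun n =>
      complex.Re (g n) * complex.Re (h n) - complex.Im (g n) * complex.Im (h n)).
      by apply: cvgB; [apply: cvgM; exact: cvg_Re|apply: cvgM; exact: cvg_Im].
    apply/funext => n; rewrite [X in complex.Re X](_ : _ = g n * h n) //.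
    by case: (g n) (h n) => [g1 g2] [h1 h2].
  rewrite [X in X @ G --> _](_ : _ = fun n =>
      complex.Re (g n) * complex.Im (h n) + complex.Im (g n) * complex.Re (h n)).
    apply: cvgD; first by apply: cvgM; [exact: cvg_Re|exact: cvg_Im].
    by apply: cvgM; [exact: cvg_Im|exact: cvg_Re].
  apply/funext => n; rewrite [X in complex.Im X](_ : _ = g n * h n) //.
  by case: (g n) (h n) => [g1 g2] [h1 h2].
- exists 1; rewrite (@limit_char_near _ 1) ?oner_eq0 //.
  by apply: filterS filterT => n.
Qed.

End limit_character.

Lemma hcode_surj (x : Z2 -> bool) : (forall n m, L n <= L m -> x n -> x m) ->
  exists w : hull, hcode w = x.
Proof.
move=> xup.
(* The translations for which the flux agrees with [x] on a given finite window form a filter base,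
   proper by [bflux_window]. Along a finer ultrafilter each [moved_flux n] is eventually constant,
   with the value prescribed by [x n]. *)
pose Fx := [set A : set Z2 | exists s : seq Z2,
  forall k, {in s, forall n, bflux (n + k) = x n} -> A k].
have FxP : ProperFilter Fx.
  apply: Build_ProperFilter_ex.
    move=> A [s sA]; have [k /sA Ak] := bflux_window s xup; by exists k.
  split.
  - by exists [::].
  - move=> A B [s sA] [t tB]; exists (s ++ t) => k skt; split.
      by apply: sA => n ns; apply: skt; rewrite mem_cat ns.
    by apply: tB => n ns; apply: skt; rewrite mem_cat ns orbT.
  - by move=> A B AB [s sA]; exists s => k /sA /AB.
have [G [GU FxG]] := ultraFilterLemma FxP.
exists (SigSub (mem_set (limit_char_character GU))).
apply/funext => n; rewrite /hcode /hull_code /=.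
rewrite [X in X == _](_ : _ = limit_char G (moved_flux n)) //.
have /limit_char_near -> : G [set k | moved_flux n k = if x n then up else um].
  apply: FxG; exists [:: n] => k /(_ n (mem_head _ _)) bn.
  by rewrite /mkset moved_fluxE addrC bn.
by case: (x n); rewrite ?eqxx // eq_sym (negbTE (expi_neq hb)).
Qed.

Lemma hull_nbhs (w : hull) (U : set hull) : nbhs w U <->
  exists2 V : set {ptws Falg -> Cplx R}, nbhs (set_val w : {ptws Falg -> Cplx R}) V &
    forall w', V (set_val w') -> U w'.
Proof.
split.
  rewrite nbhsE => -[B [[V oV <-] Vw] BU].
  by exists V; [exact: open_nbhs_nbhs|].
move=> [V Vw VU].
have : nbhs w (set_val @^-1` V) by exact: (@initial_continuous _ _ set_val w V Vw).
by apply: filterS => w'; exact: VU.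
Qed.

(** Agreement at one site is a neighbourhood because the code takes two separated values.
    Conversely, the elements [g] whose evaluation is continuous for the cylinder neighbourhoods
    satisfy the closure conditions of [Falg_ind]; for uniform limits this is a three-term estimate
    based on [char_bound]. *)
Lemma hcode_nbhs (w : hull) (U : set hull) : nbhs w U <->
  exists s : seq Z2, forall w', {in s, hcode w' =1 hcode w} -> U w'.
Proof.
split; last first.
  move=> [s sU]; apply: (@filterS _ (nbhs w) _ [set w' | {in s, hcode w' =1 hcode w}]) => //.
  elim: s {sU} => [|n s IH]; first by apply: filterS filterT.
  have : nbhs w [set w' | hcode w' n = hcode w n].
    apply/hull_nbhs; pose f := set_val w : {ptws Falg -> Cplx R}.
    (* An open ball of radius [|up - um|] about one of the two values misses the other. *)
    have gap : 0 < `|up - um| by rewrite normr_gt0 subr_eq0 expi_neq.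
    have near_f := ptws_near (f := f) (near_norm_lt (f (moved_flux n)) gap).
    eexists; first exact: near_f.
    move=> w'.
    have -> : [set g : Falg -> Cplx R |
          `|f (moved_flux n) - g (moved_flux n)| < `|up - um|] (set_val w') = (`|hull_code w n - hull_code w' n| < `|up - um|) by [].
    rewrite /mkset !hull_code_hcode.
    by case: (hcode w n) (hcode w' n) => [] []; rewrite // 1?distrC ltxx.
  apply: filterS2 IH => w' e1 e2 k; rewrite inE => /predU1P[-> //|]; exact: e1.
move=> /hull_nbhs [V Vw VU].
pose N := [set A : set hull | exists s : seq Z2,
  forall w', {in s, hcode w' =1 hcode w} -> A w'].
have NF : Filter N.
  split.
  - by exists [::].
  - move=> A B [s sA] [t tB]; exists (s ++ t) => k skt; split.
      by apply: sA => n ns; apply: skt; rewrite mem_cat ns.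
    by apply: tB => n ns; apply: skt; rewrite mem_cat ns orbT.
  - by move=> A B AB [s sA]; exists s => k /sA /AB.
suff : {ptws, fmap (set_val : hull -> Falg -> Cplx R) N --> (set_val w : Falg -> Cplx R)}.
  by move=> /(_ V Vw) [s sV]; exists s => w' /sV; exact: VU.
suff cg (g : Falg) : fmap (fun w' : hull => set_val w' g) N --> set_val w g.
  by apply: cvg_ptws => g; exact: cg.
move: g; apply: (Falg_ind hb).
- apply: cvg_near_cst.
  by apply: filterE => w'; rewrite !(char1 (hull_val_character _)).
- move=> c g h cg ch.
  rewrite (charD (hull_val_character w)) (charZ (hull_val_character w)).
  rewrite (_ : (fun w' : hull => _) = fun w' => c * set_val w' g + set_val w' h).
    by apply: cvgD; [apply: cvgM; [exact: cvg_cst|exact: cg]|exact: ch].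
  by apply/funext => w'; rewrite (charD (hull_val_character w')) (charZ (hull_val_character w')).
- move=> g h cg ch; rewrite (charM (hull_val_character w)).
  rewrite (_ : (fun w' : hull => _) = fun w' => set_val w' g * set_val w' h).
    by apply: cvgM; [exact: cg|exact: ch].
  by apply/funext => w'; rewrite (charM (hull_val_character w')).
- move=> g happ; apply/cvgrPdist_lt => e' e'0.
  have /complex_realP [e eE] : e' \is Num.real by rewrite realE (ltW e'0).
  have e0 : 0 < e by rewrite -ltcR -eE.
  rewrite {}eE {e' e'0}.
  have e3 : 0 < e / 3 by rewrite divr_gt0.
  have [h /cvgrPdist_lt ch gh] := happ _ e3.
  have := ch (((e / 3)%:C)%C); rewrite ltcR => /(_ e3); apply: filterS => w' /= hw'.
  have bd (v : hull) : `|set_val v (g - h)| <= ((e / 3)%:C)%C.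
    by apply: (char_bound (hull_val_character v)) => n; exact/ltW/gh.
  have -> : set_val w g - set_val w' g =
     set_val w (g - h) + (set_val w h - set_val w' h) - set_val w' (g - h).
    rewrite (charB (hull_val_character w)) (charB (hull_val_character w')).
    by ring.
  have -> : (e%:C)%C = ((e / 3)%:C)%C + ((e / 3)%:C)%C + ((e / 3)%:C)%C.
    by rewrite -!rmorphD; congr (_%:C)%C; lra.
  apply: le_lt_trans (ler_normB _ _) _; apply: ltr_leD => //.
  by apply: le_lt_trans (ler_normD _ _) _; apply: ler_ltD.
- move=> gamma; rewrite shift_FalgE.
  apply: cvg_near_cst; exists [:: - gamma] => w' /(_ _ (mem_head _ _)) e1.
  by rewrite -/(hull_code w' _) -/(hull_code w _) !hull_code_hcode e1.
Qed.

Theorem hull_cut_coding : cut_coding L hcode.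
Proof.
split; first exact: slope_formB.
- exact: slope_form_nontrivial.
- exact: hcode_inj.
- exact: hcode_up.
- exact: hcode_surj.
- exact: hcode_nbhs.
Qed.

End hull_topology.

(** * Topology of the space of upward closed sets *)

Section cut_system_topology.
Context {R : realType} {L : Z2 -> R} {T : ptopologicalType} {b : T -> Z2 -> bool}.
Context (cb : cut_coding L b).

Notation borel := (g_sigma_algebraType (@open T)).

Definition gap (n m : Z2) : set T := [set w | ~~ b w n /\ b w m].

Definition cut_interior : set T :=
  [set w | (exists n, ~~ b w n) /\ (exists m, b w m)].

Lemma cut_L0 : L 0 = 0.
Proof. by rewrite -(subrr 0) (cut_additive cb) subrr. Qed.

Lemma cut_LN n : L (- n) = - L n.
Proof. by rewrite -sub0r (cut_additive cb) cut_L0 sub0r. Qed.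

Lemma cut_LD n m : L (n + m) = L n + L m.
Proof. by rewrite -(opprK m) (cut_additive cb) cut_LN !opprK. Qed.

Lemma cut_LMn n k : L (n *+ k) = L n *+ k.
Proof. by elim: k => [|k IH]; rewrite ?cut_L0 // !mulrS cut_LD IH. Qed.

Lemma cut_openP (U : set T) : open U <-> forall w, U w ->
  exists s : seq Z2, forall w', {in s, b w' =1 b w} -> U w'.
Proof.
rewrite openE; split=> oU w Uw.
  exact/(cut_nbhs cb)/oU.
exact/(cut_nbhs cb)/oU.
Qed.

Lemma open_cut n (v : bool) : open [set w | b w n = v].
Proof.
apply/cut_openP => w /= wv; exists [:: n] => w' /(_ n (mem_head _ _)) ->; exact: wv.
Qed.

Lemma closed_cut n (v : bool) : closed [set w | b w n = v].
Proof.
rewrite -openC [X in open X](_ : _ = [set w | b w n = ~~ v]); first exact: open_cut.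
by apply/funext => w /=; apply/propext; case: (b w n) v => [] [].
Qed.

Lemma gapE n m : gap n m = [set w | b w n = false] `&` [set w | b w m = true].
Proof.
apply/seteqP; split=> w /= [wn wm]; split=> //; first exact/negbTE.
by rewrite wn.
Qed.

Lemma open_gap n m : open (gap n m).
Proof. by rewrite gapE; apply: openI; exact: open_cut. Qed.

Lemma closed_gap n m : closed (gap n m).
Proof. by rewrite gapE; apply: closedI; exact: closed_cut. Qed.

Lemma gap_interior n m : gap n m `<=` cut_interior.
Proof. by move=> w [wn wm]; split; [exists n|exists m]. Qed.

Lemma cut_false_le w n m : ~~ b w m -> L n <= L m -> ~~ b w n.
Proof. by move=> wm nm; apply: contra wm; exact: (cut_up cb). Qed.

Lemma cut_lt w n m : gap n m w -> L n < L m.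
Proof.
by move=> [wn wm]; rewrite ltNge; apply: contra wn => mn; exact: (cut_up cb) mn wm.
Qed.

Lemma gap_mono n m n' m' : L n' <= L n -> L m <= L m' -> gap n m `<=` gap n' m'.
Proof.
move=> nn mm w [wn wm]; split; first exact: cut_false_le wn nn.
exact: (cut_up cb) mm wm.
Qed.

Lemma gapI n m n' m' : exists n'' m'', gap n m `&` gap n' m' = gap n'' m''.
Proof.
exists (if L n <= L n' then n' else n), (if L m <= L m' then m else m').
apply/seteqP; split=> w.
  by move=> [[wn wm] [wn' wm']]; split; case: ifP.
move=> [wn wm]; split; split.
- by case: ifPn wn => // nn' wn'; exact: cut_false_le wn' nn'.
- by case: ifPn wm => // mm' wm'; apply: (cut_up cb) wm'; rewrite ltW // ltNge.
- by case: ifPn wn => // nn' wn'; apply: cut_false_le wn' _; rewrite ltW // ltNge.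
- by case: ifPn wm => // mm' wm'; exact: (cut_up cb) mm' wm'.
Qed.

Lemma gap_basis w (U : set T) : cut_interior w -> nbhs w U ->
  exists n m, gap n m w /\ gap n m `<=` U.
Proof.
move=> [[n0 wn0] [m0 wm0]] /(cut_nbhs cb) [s sU].
(* Adding [n0] and [m0] to the window ensures that it has sites outside and inside [w]. A cut that
   agrees with [w] at the highest outside site and at the lowest inside site agrees on the whole
   window. *)
pose s' := [:: n0, m0 & s].
have hf : has (fun n => ~~ b w n) s' by rewrite /= wn0.
have ht : has (b w) s' by rewrite /= wm0 orbT.
have [n [_ wn] nmax] := seq_argmax L hf.
have [m [_ wm] mmin] := seq_argmin L ht.
exists n, m; split=> // w' [wn' wm']; apply: sU => k ks.
have ks' : k \in s' by rewrite !inE ks !orbT.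
case wk : (b w k); first exact: (cut_up cb) (mmin _ ks' wk) wm'.
by apply/negbTE; apply: cut_false_le wn' _; apply: nmax; rewrite // wk.
Qed.

Lemma cut_point (v : bool) : exists w, b w = (fun=> v).
Proof. exact: (cut_surj cb). Qed.

Lemma not_interior w : ~ cut_interior w -> b w = (fun=> true) \/ b w = (fun=> false).
Proof.
move=> wi; have [wn|wn] := pselect (exists n, ~~ b w n).
  right; apply/funext => m; apply/negbTE/negP => wm; apply: wi; split=> //; by exists m.
by left; apply/funext => n; apply: contraT => wn'; case: wn; exists n.
Qed.

Lemma open_cut_interior : open cut_interior.
Proof.
rewrite openE => w wi; have [n [m [nm _]]] := gap_basis wi filterT.
by apply: (filterS (@gap_interior n m)); apply: open_nbhs_nbhs; split; [exact: open_gap|].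
Qed.

Lemma cut_hausdorff : hausdorff_space T.
Proof.
rewrite open_hausdorff => w w' ww'.
have [n nn] : exists n, b w n <> b w' n.
  apply: contrapT => nex; move/eqP: ww'; apply; apply: (cut_inj cb).
  by apply/funext => n; apply: contrapT => nn; apply: nex; exists n.
exists ([set v | b v n = b w n], [set v | b v n = b w' n]) => /=.
  by rewrite !inE.
split; [exact: open_cut|exact: open_cut|].
by apply/eqP; rewrite -subset0 => v /= [->].
Qed.

Lemma cut_closed1 (w : T) : closed [set w].
Proof. exact: (accessible_closed_set1 (hausdorff_accessible cut_hausdorff)). Qed.

(** An ultrafilter decides the code at every site. The resulting code is upward closed, since two
    sites can be compared on a common member of the filter, so it belongs to a point, which is the
    limit. *)
Lemma cut_compact : compact [set: T].
Proof.
rewrite compact_ultra => F FU _.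
pose x n := `[< F [set w | b w n = true] >].
have xF n : F [set w | b w n = x n].
  rewrite /x; case: asboolP => // nF.
  have [//|] := in_ultra_setVsetC [set w | b w n = true] FU.
  by apply: filterS => w /= /negP /negbTE.
have [n m nm xn|w wx] := (cut_surj cb) x.
  have [w [wn wm]] := filter_ex (filterI (xF n) (xF m)).
  by rewrite -wm; apply: (cut_up cb) nm _; rewrite wn.
exists w; split=> // U /(cut_nbhs cb) [s sU].
have : F [set w' | {in s, b w' =1 b w}].
  elim: s {sU} => [|n s IH]; first by apply: filterS filterT.
  apply: filterS2 (xF n) IH => w' e1 e2 k; rewrite inE => /predU1P[->|]; last exact: e2.
  by rewrite e1 wx.
exact: filterS.
Qed.

Section exhaustion.
Context (e : Z2) (e0 : 0 < L e).

Definition exhaust (k : nat) : set T := gap (- (e *+ k)) (e *+ k).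

Lemma exhaust_mono j k : (j <= k)%N -> exhaust j `<=` exhaust k.
Proof.
move=> jk; have : L (e *+ j) <= L (e *+ k) by rewrite !cut_LMn ler_wpMn2l // ltW.
by move=> ejk; apply: gap_mono => //; rewrite !cut_LN lerN2.
Qed.

Lemma archimedes_L n : exists k, forall j, (k <= j)%N -> L n <= L (e *+ j).
Proof.
exists (Num.truncn (L n / L e)).+1 => j kj.
rewrite cut_LMn -mulr_natl -ler_pdivrMr //.
by apply: le_trans (ltW (truncnS_gt _)) _; rewrite ler_nat.
Qed.

Lemma exhaust_near w : cut_interior w ->
  exists k, forall j, (k <= j)%N -> exhaust j w.
Proof.
move=> [[n wn] [m wm]].
have [k1 k1n] := archimedes_L (- n); have [k2 k2m] := archimedes_L m.
exists (maxn k1 k2) => j; rewrite geq_max => /andP[/k1n h1 /k2m h2]; split.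
  by apply: cut_false_le wn _; rewrite cut_LN lerNl -cut_LN.
exact: (cut_up cb) h2 wm.
Qed.

Lemma bigcup_exhaust : \bigcup_k exhaust k = cut_interior.
Proof.
apply/seteqP; split=> w; first by move=> [k _]; exact: gap_interior.
by move=> /exhaust_near [k kw]; exists k => //; exact: kw.
Qed.

Lemma compact_exhaust (K : set T) : compact K -> K `<=` cut_interior ->
  exists k, K `<=` exhaust k.
Proof.
move=> /compact_near_coveringP cK Ki.
have [|k _ /(_ k (leqnn k)) kK] := cK nat \oo (fun k w => exhaust k w); last by exists k.
move=> w /Ki wi; have [k kw] := exhaust_near wi.
exists (exhaust k, [set j | (k <= j)%N]) => /=.
  split; last by exists k.
  apply: open_nbhs_nbhs; split; [exact: open_gap|exact: kw].
by move=> [w' j] /= [w'k kj]; exact: exhaust_mono kj _ w'k.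
Qed.

End exhaustion.

End cut_system_topology.

(** * Invariant measures *)

Section cut_system_measure.
Context {R : realType} {L : Z2 -> R} {T : ptopologicalType} {b : T -> Z2 -> bool}.
Context (cb : cut_coding L b).

Notation borel := (g_sigma_algebraType (@open T)).
Notation gap := (@gap T b).
Notation interior := (@cut_interior T b).

Definition const_code (v : bool) : set T := [set w | b w = fun=> v].

Lemma const_code_eq v w w' : const_code v w -> const_code v w' -> w = w'.
Proof. by move=> wv wv'; apply: (cut_inj cb); rewrite wv wv'. Qed.

Lemma measurable_open (U : set borel) : open (U : set T) -> measurable U.
Proof. exact: sub_sigma_algebra. Qed.

Lemma measurable_gap n m : measurable (gap n m : set borel).
Proof. by apply: measurable_open; exact: (open_gap cb). Qed.

Lemma measurable_interior : measurable (interior : set borel).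
Proof. by apply: measurable_open; exact: (open_cut_interior cb). Qed.

Lemma measurable_point (w : T) : measurable ([set w] : set borel).
Proof.
rewrite -[X in measurable X]setCK; apply: measurableC; apply: measurable_open.
by apply: closed_openC; exact: (cut_closed1 cb).
Qed.

Lemma const_codeE v w : const_code v w -> const_code v = [set w].
Proof.
by move=> wv; apply/seteqP; split=> [w' /const_code_eq|w' ->//]; exact.
Qed.

Lemma measurable_const v : measurable (const_code v : set borel).
Proof.
by have [w /const_codeE ->] := cut_point cb v; exact: measurable_point.
Qed.

Lemma interiorC : ~` interior = const_code true `|` const_code false.
Proof.
apply/seteqP; split=> w; first exact: not_interior.
by move=> [] wc [[n +] [m +]]; rewrite wc.
Qed.

Definition gap_family : set (set T) :=
  [set A | (exists n m, A = gap n m) \/ (exists v, A = const_code v)].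

Lemma gap_nn n : gap n n = set0.
Proof. by rewrite -subset0 => w [/negP]. Qed.

Lemma gap_const n m v : gap n m `&` const_code v = set0.
Proof. by rewrite -subset0 => w [[wn wm] wc]; move: wn wm; rewrite wc; case: v {wc}. Qed.

Lemma gap_familyI : setI_closed gap_family.
Proof.
have set0G : gap_family set0 by left; exists 0, 0; rewrite gap_nn.
move=> A B [[n [m ->]]|[v ->]] [[n' [m' ->]]|[v' ->]].
- by have [n'' [m'' ->]] := gapI cb n m n' m'; left; exists n'', m''.
- by rewrite gap_const.
- by rewrite setIC gap_const.
- have [->|vv'] := eqVneq v v'; first by rewrite setIid; right; exists v'.
  suff -> : const_code v `&` const_code v' = set0 by [].
  rewrite -subset0 => w [wv wv']; have := congr1 (@^~ 0) wv.
  by move/(congr1 (@^~ 0)): wv' => /= -> /esym/eqP; rewrite (negbTE vv').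
Qed.

(** By [gap_basis] an open set is its trace on the two constant codes together with the gaps it
    contains, and gaps are indexed by the countable set of pairs of sites. *)
Lemma borel_gap_family : (measurable : set (set borel)) = <<s gap_family >>.
Proof.
apply/seteqP; split; last first.
  apply: smallest_sub; first exact: sigma_algebra_measurable.
  move=> _ [[n [m ->]]|[v ->]]; first exact: measurable_gap.
  exact: measurable_const.
apply: smallest_sub; first exact: smallest_sigma_algebra.
move=> U oU.
have UE : U = (U `&` const_code true) `|` (U `&` const_code false) `|`
   \bigcup_(p : Z2 * Z2) (if `[< gap p.1 p.2 `<=` U >] then gap p.1 p.2 else set0).
  apply/seteqP; split=> [w Uw|w [[[]//|[]//]|[p _]]]; last first.
    by case: asboolP => // + wp; exact.
  have [wi|/not_interior [wt|wf]] := pselect (interior w); last first.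
  - by left; right.
  - by left; left.
  have wU : nbhs (w : T) U by exact: open_nbhs_nbhs.
  have [n [m [nm nmU]]] := gap_basis cb wi wU.
  by right; exists (n, m) => //=; case: asboolP.
have UC v : <<s gap_family >> (U `&` const_code v).
  have [w wv] := cut_point cb v.
  have [Uw|nUw] := pselect (U w).
    rewrite setIidr; last by rewrite (const_codeE wv) => _ ->.
    by apply: sub_sigma_algebra; right; exists v.
  suff -> : U `&` const_code v = set0 by exact: sigma_algebra0.
  by rewrite -subset0 (const_codeE wv) => w' [Uw' w'w]; apply: nUw; rewrite -w'w.
rewrite UE; apply: (@measurableU _ (g_sigma_algebraType gap_family)).
  by apply: (@measurableU _ (g_sigma_algebraType gap_family)); exact: UC.
apply: (@countable_bigcupT_measurable _ (g_sigma_algebraType gap_family)).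
  exact: countableP.
move=> p.
case: asboolP => _; last exact: sigma_algebra0.
by apply: sub_sigma_algebra; left; exists p.1, p.2.
Qed.

Lemma eq_cut_measure (m1 m2 : {measure set borel -> \bar R}) :
  (forall n m, (m1 (gap n m) < +oo)%E) -> (forall v, (m1 (const_code v) < +oo)%E) ->
  (forall n m, m1 (gap n m) = m2 (gap n m)) ->
  (forall v, m1 (const_code v) = m2 (const_code v)) ->
  forall A, measurable A -> m1 A = m2 A.
Proof.
move=> fg fc eg ec; have [e e0] := cut_nontrivial cb.
(* A countable cover by sets of finite measure: indices 0 and 1 are the two constant codes, the
   others exhaust the interior. *)
pose g k := if k is k'.+2 then @exhaust T b e k' else const_code (k == 0%N).
apply: (@measure_unique _ R borel gap_family g).
- exact: borel_gap_family.
- exact: gap_familyI.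
- by move=> [|[|k]]; [right; exists true|right; exists false|left; do 2 eexists].
- rewrite -subTset => w _.
  have [|/not_interior [wt|wf]] := pselect (interior w).
  + by rewrite -(bigcup_exhaust cb e0) => -[k _ kw]; exists k.+2.
  + by exists 0%N.
  + by exists 1%N.
- by move=> _ [[n [m ->]]|[v ->]].
- by move=> [|[|k]]; [exact: fc|exact: fc|exact: fg].
Qed.

End cut_system_measure.

(** * Uniqueness of the invariant measure on the interior *)

Lemma le0_natmul_bounded {R : realType} (y C : R) :
  (forall j : nat, j%:R * y <= C) -> y <= 0.
Proof.
move=> yC; rewrite leNgt; apply/negP => y0.
have := yC (Num.truncn (C / y)).+1; rewrite leNgt => /negP; apply.
by rewrite -ltr_pdivrMr // truncnS_gt.
Qed.

Section cut_system_invariant.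
Context {R : realType} {L : Z2 -> R} {T : ptopologicalType} {b : T -> Z2 -> bool}.
Context (cb : cut_coding L b).
Context {s : Z2 -> T -> T} (sb : forall gamma w n, b (s gamma w) n = b w (n + gamma)).

Notation borel := (g_sigma_algebraType (@open T)).
Notation gap := (@gap T b).
Notation interior := (@cut_interior T b).
Notation const_code := (@const_code T b).

Definition shift_invariant (m : set borel -> \bar R) : Prop :=
  forall gamma (A : set borel), measurable A -> m (s gamma @^-1` A) = m A.

Definition gap_finite (m : set borel -> \bar R) : Prop :=
  forall n k, (m (gap n k) < +oo)%E.

Lemma preimage_gap gamma n k : s gamma @^-1` gap n k = gap (n + gamma) (k + gamma).
Proof. by apply/funext => w; rewrite /preimage /mkset /gap /mkset !sb. Qed.

Lemma preimage_interior gamma : s gamma @^-1` interior = interior.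
Proof.
apply/seteqP; split=> w.
  by move=> [[n +] [k +]]; rewrite !sb => wn wk; split; [exists (n + gamma)|exists (k + gamma)].
move=> [[n wn] [k wk]]; split; [exists (n - gamma)|exists (k - gamma)];
  by rewrite sb subrK.
Qed.

Lemma preimage_const gamma v : s gamma @^-1` const_code v = const_code v.
Proof.
apply/seteqP; split=> w wv; apply/funext => n.
  by move: wv => /(congr1 (@^~ (n - gamma))); rewrite sb subrK.
by rewrite sb wv.
Qed.

Section one_measure.
Context (m : {measure set borel -> \bar R}) (mfin : gap_finite m) (minv : shift_invariant m).

Let phi n := fine (m (gap 0 n)).

Lemma gap_measureE n k : m (gap n k) = (phi (k - n))%:E.
Proof.
rewrite fineK; last by rewrite ge0_fin_numE //; exact: mfin.
by rewrite -(minv (- n) (measurable_gap cb n k)) preimage_gap subrr.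
Qed.

Lemma gap_split n p k : L n <= L p -> L p <= L k -> gap n k = gap n p `|` gap p k.
Proof.
move=> np pk; apply/seteqP; split=> w.
  by move=> [wn wk]; case wp : (b w p); [left|right]; split=> //; rewrite wp.
move=> [[wn wp]|[wp wk]]; split=> //; first exact: (cut_up cb) pk wp.
exact: (cut_false_le cb) wp np.
Qed.

Lemma phi_add n k : 0 <= L n -> 0 <= L k -> phi (n + k) = phi n + phi k.
Proof.
move=> n0 k0; apply: EFin_inj; rewrite EFinD.
have := gap_measureE 0 (n + k); rewrite subr0 => <-.
have := gap_measureE 0 n; rewrite subr0 => <-.
have := gap_measureE n (n + k); rewrite addrAC subrr add0r => <-.
rewrite (@gap_split 0 n) ?cut_L0 ?(cut_L0 cb) //; last by rewrite (cut_LD cb) lerDl.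
rewrite measureU //; try exact: (measurable_gap cb).
by rewrite -subset0 => w [[_ wn] [/negP]].
Qed.

Lemma phi_mono n k : L n <= L k -> phi n <= phi k.
Proof.
move=> nk; rewrite -lee_fin.
have := gap_measureE 0 n; rewrite subr0 => <-.
have := gap_measureE 0 k; rewrite subr0 => <-.
apply: le_measure; rewrite ?inE; try exact: (measurable_gap cb).
exact: (gap_mono cb).
Qed.

Lemma phi_ge0 n : 0 <= phi n.
Proof. exact: fine_ge0. Qed.

Lemma phi_muln n j : 0 <= L n -> phi (n *+ j) = j%:R * phi n.
Proof.
move=> n0; elim: j => [|j IH].
  by rewrite mulr0n mul0r /phi gap_nn measure0.
rewrite mulrS phi_add // ?(cut_LMn cb) ?mulrn_wge0 // IH -[in RHS]natr1.
by rewrite mulrDl mul1r addrC.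
Qed.

(** For each [j] some [i] satisfies [i L(e) <= j L(n) <= (i + 1) L(e)]. As [phi] is additive and
    monotone, the same inequalities hold with [phi] in place of [L]. Hence [j] times the difference
    of the two sides, with either sign, is at most [phi e * L e] for every [j]. *)
Lemma phi_linear e n : 0 < L e -> 0 <= L n -> phi n * L e = phi e * L n.
Proof.
move=> e0 n0.
have sandwich (j : nat) : exists i : nat, [/\ i%:R * L e <= j%:R * L n,
    j%:R * L n <= i.+1%:R * L e, i%:R * phi e <= j%:R * phi n &
    j%:R * phi n <= i.+1%:R * phi e].
  exists (Num.truncn (j%:R * L n / L e)); set i := Num.truncn _.
  have h1 : i%:R * L e <= j%:R * L n.
    by rewrite -ler_pdivlMr // truncn_le // divr_ge0 ?mulr_ge0 // ltW.
  have h2 : j%:R * L n <= i.+1%:R * L e.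
    by rewrite -ler_pdivrMr // ltW // truncnS_gt.
  split=> //.
    rewrite -(phi_muln i (ltW e0)) -(phi_muln j n0); apply: phi_mono.
    by rewrite !(cut_LMn cb) -(mulr_natl (L e)) -(mulr_natl (L n)).
  rewrite -(phi_muln j n0) -(phi_muln i.+1 (ltW e0)); apply: phi_mono.
  by rewrite !(cut_LMn cb) -(mulr_natl (L e)) -(mulr_natl (L n)).
have P0 := phi_ge0 e.
apply/eqP; rewrite eq_le; apply/andP; split; rewrite -subr_le0;
  apply: (@le0_natmul_bounded _ _ (phi e * L e)) => j;
  have [i [h1 h2 h3 h4]] := sandwich j; rewrite -natr1 in h2 h4.
  have : j%:R * phi n * L e <= (i%:R + 1) * phi e * L e by rewrite ler_wpM2r // ltW.
  have : phi e * (i%:R * L e) <= phi e * (j%:R * L n) by rewrite ler_wpM2l.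
  lra.
have : i%:R * phi e * L e <= j%:R * phi n * L e by rewrite ler_wpM2r // ltW.
have : phi e * (j%:R * L n) <= phi e * ((i%:R + 1) * L e) by rewrite ler_wpM2l.
lra.
Qed.

Lemma gap_measure_linear : exists2 a : R, 0 <= a &
  forall n k, L n <= L k -> m (gap n k) = (a * (L k - L n))%:E.
Proof.
have [e e0] := cut_nontrivial cb.
exists (phi e / L e); first by rewrite divr_ge0 ?phi_ge0 // ltW.
move=> n k nk; rewrite gap_measureE -(cut_additive cb) mulrAC -phi_linear //.
  by rewrite mulfK // gt_eqF.
by rewrite (cut_additive cb) subr_ge0.
Qed.

End one_measure.

Lemma interior_null (m : {measure set borel -> \bar R}) :
  (forall n k, m (gap n k) = 0%E) -> m interior = 0%E.
Proof.
move=> m0; have [e e0] := cut_nontrivial cb.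
have := @measure_sigma_subadditive _ _ _ m interior (@exhaust T b e).
move=> /(_ (fun k => measurable_gap cb _ _) (measurable_interior cb)).
have sub : interior `<=` \bigcup_k @exhaust T b e k by rewrite (bigcup_exhaust cb e0).
move=> /(_ sub); rewrite eseries0; last by move=> i _ _; exact: m0.
by move=> mle; apply/eqP; rewrite eq_le mle measure_ge0.
Qed.

Lemma gap_empty n k : L k <= L n -> gap n k = set0.
Proof. by move=> kn; rewrite -subset0 => w /(cut_lt cb); rewrite ltNge kn. Qed.

(* Both measures are multiples of [L k - L n] on [gap n k]. *)
Lemma invariant_measure_unique (m1 m2 : {measure set borel -> \bar R}) :
  gap_finite m1 -> shift_invariant m1 -> gap_finite m2 -> shift_invariant m2 ->
  m2 interior <> 0%E ->
  exists2 c : R, 0 <= c & forall A : set borel, measurable A ->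
    m1 (A `&` interior) = (c%:E * m2 (A `&` interior))%E.
Proof.
move=> f1 i1 f2 i2 m2n0.
have [a1 a10 a1E] := gap_measure_linear f1 i1.
have [a2 a20 a2E] := gap_measure_linear f2 i2.
have a2n0 : a2 != 0.
  apply/eqP => a2z; apply: m2n0; apply: interior_null => n k.
  have [nk|/ltW kn] := leP (L n) (L k); first by rewrite a2E // a2z mul0r.
  by rewrite gap_empty // measure0.
have c0 : 0 <= a1 / a2 by rewrite divr_ge0.
exists (a1 / a2) => // A mA.
have mi := measurable_interior cb.
(* Restriction to the interior gives mass 0 to the constant codes, which settles the conditions of
   [eq_cut_measure] there. *)
pose m1' : {measure set borel -> \bar R} := mrestr m1 mi.
pose m2' : {measure set borel -> \bar R} := mscale (NngNum c0) (mrestr m2 mi).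
have gI n k : gap n k `&` interior = gap n k by apply: setIidl; exact: gap_interior.
have cI v : const_code v `&` interior = set0.
  by rewrite -subset0 => w [wv [[n +] [k +]]]; rewrite wv; case: v {wv}.
have m1E B : m1' B = m1 (B `&` interior) by [].
have m2E B : m2' B = ((a1 / a2)%:E * m2 (B `&` interior))%E by [].
rewrite -m1E -m2E; apply: (eq_cut_measure cb) => // [n k|v|n k|v].
- by rewrite m1E gI.
- by rewrite m1E cI measure0.
- rewrite m1E m2E gI.
  have [nk|/ltW kn] := leP (L n) (L k); last by rewrite gap_empty // !measure0 mule0.
  by rewrite a1E // a2E // -EFinM mulrA divfK.
- by rewrite m1E m2E cI !measure0 mule0.
Qed.

End cut_system_invariant.

(** * Regularity of measures that are finite on gaps *)

Section cut_system_regular.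
Context {R : realType} {L : Z2 -> R} {T : ptopologicalType} {b : T -> Z2 -> bool}.
Context (cb : cut_coding L b).

Notation borel := (g_sigma_algebraType (@open T)).
Notation gap := (@gap T b).
Notation interior := (@cut_interior T b).
Notation const_code := (@const_code T b).

Context (m : {measure set borel -> \bar R}) (mfin : gap_finite (b := b) m).

Lemma measurable_closed (K : set borel) : closed (K : set T) -> measurable K.
Proof.
move=> cK; rewrite -[X in measurable X]setCK; apply: measurableC.
by apply: measurable_open; exact: closed_openC.
Qed.

Section sandwich.
Context (n0 k0 : Z2).
Notation J := (gap n0 k0).

(** The error is measured only inside the gap [J], where [m] is finite. Asking for the closed and
    the open set together makes the property symmetric under complements. *)
Definition sandwiched (A : set T) : Prop := forall e : R, 0 < e ->
  exists K U : set T, [/\ closed K, open U, K `<=` A, A `<=` U &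
    (m ((U `\` K) `&` J : set borel) <= e%:E)%E].

Let mJ : measurable (J : set borel). Proof. exact: (measurable_gap cb). Qed.

Let mUKJ (U K : set T) : open U -> closed K -> measurable ((U `\` K) `&` J : set borel).
Proof.
move=> oU cK; apply: measurableI => //; apply: measurableD.
  exact: measurable_open.
exact: measurable_closed.
Qed.

Lemma sandwichedC A : sandwiched A -> sandwiched (~` A).
Proof.
move=> sA e e0; have [K [U [cK oU KA AU mUK]]] := sA e e0.
exists (~` U), (~` K); split; [exact: open_closedC|exact: closed_openC| | |].
- exact: subsetC.
- exact: subsetC.
- by have -> : ~` K `\` ~` U = U `\` K by rewrite setDE setCK setIC.
Qed.

Lemma sandwiched_bigcup (F : (set T)^nat) :
  (forall i, sandwiched (F i)) -> sandwiched (\bigcup_i F i).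
Proof.
move=> sF e e0; have e2 : 0 < e / 2 by rewrite divr_gt0.
have ei i : 0 < e / 2 / (2 ^ i.+1)%:R by rewrite divr_gt0 // ltr0n expn_gt0.
have /choice [KU KUP] : forall i, exists KU : set T * set T,
    [/\ closed KU.1, open KU.2, KU.1 `<=` F i, F i `<=` KU.2 &
    (m ((KU.2 `\` KU.1) `&` J : set borel) <= (e / 2 / (2 ^ i.+1)%:R)%:E)%E].
  by move=> i; have [K [U KUi]] := sF i _ (ei i); exists (K, U).
pose U := \bigcup_i (KU i).2.
have oU : open U by apply: bigcup_open => i _; case: (KUP i).
(* The union of all the closed sets need not be closed, so it is truncated at [N]. The errors [B N]
   decrease to a set of measure at most [e / 2], and continuity from above, valid as [J] has finite
   measure, brings some [B N] below [e]. *)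
pose KN N := \bigcup_(i < N) (KU i).1.
have cKN N : closed (KN N) by apply: closed_bigcup => // i _; case: (KUP i).
pose B N : set borel := (U `\` KN N) `&` J.
have mB N : measurable (B N) by apply: mUKJ.
have BE : \bigcap_N B N = (U `\` \bigcup_i (KU i).1) `&` J.
  apply/seteqP; split=> w.
    move=> Bw; have [[Uw _] Jw] := Bw 0%N I; split=> //; split=> // -[i _ Kw].
    by have [[_ +] _] := Bw i.+1 I; apply; exists i => /=.
  move=> [[Uw nK] Jw] N _; split=> //; split=> // -[i _ Kw].
  by apply: nK; exists i.
have mBI : measurable (\bigcap_N B N : set borel) by exact: bigcapT_measurable.
have mle : (m (\bigcap_N B N) <= (e / 2)%:E)%E.
  apply: le_trans (epsilon_trick0 xpredT (ltW e2)).
  apply: le_trans (_ : (\sum_(i <oo)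
      m (((KU i).2 `\` (KU i).1) `&` J : set borel) <= _)%E); last first.
    by apply: lee_nneseries => // i _; case: (KUP i).
  apply: measure_sigma_subadditive => //.
    by move=> i; case: (KUP i) => *; apply: mUKJ.
  rewrite BE => w [[[i _ Uw] nK] Jw]; exists i => //; split=> //; split=> // Kw.
  by apply: nK; exists i.
have finB : (m (B 0%N) < +oo)%E.
  apply: le_lt_trans (mfin n0 k0); apply: le_measure; rewrite ?inE //.
  by move=> w [].
have niB : nonincreasing_seq B.
  move=> i j ij; apply/subsetPset => w [[Uw nK] Jw]; split=> //; split=> // -[k /= ki Kw].
  by apply: nK; exists k => //=; exact: leq_trans ki ij.
have nb : nbhs (m (\bigcap_N B N)) [set x | (x < e%:E)%E].
  apply: open_nbhs_nbhs; split; first exact: open_ereal_lt_ereal.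
  by apply: le_lt_trans mle _; rewrite lte_fin ltr_pdivrMr // ltr_pMr // ltr1n.
have [N _ /(_ N (leqnn N)) mN] := nonincreasing_cvg_mu finB mB mBI niB nb.
exists (KN N), U; split=> //.
- by move=> w [i _ Kw]; exists i => //; case: (KUP i) => _ _ + _ _; exact.
- by move=> w [i _ Fw]; exists i => //; case: (KUP i) => _ _ _ + _; exact.
- exact: ltW.
Qed.

Lemma borel_sandwiched (A : set borel) : measurable A -> sandwiched A.
Proof.
move=> mA; have : <<s @gap_family T b >> A by rewrite -(borel_gap_family cb).
apply: smallest_sub.
  split.
  - move=> e e0; exists set0, set0; split; [exact: closed0|exact: open0|by []|by []|].
    by rewrite set0D set0I measure0 lee_fin ltW.
  - by move=> B; rewrite setTD; exact: sandwichedC.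
  - exact: sandwiched_bigcup.
move=> _ [[n [k ->]]|[v ->]] e e0.
  exists (gap n k), (gap n k); split; [exact: (closed_gap cb)|exact: (open_gap cb)|by []|by []|].
  by rewrite setDv set0I measure0 lee_fin ltW.
(* The complement of [J] is an open neighbourhood of the constant code, and it leaves no error
   inside [J]. *)
exists (const_code v), (~` J); split=> //.
- have [w wv] := cut_point cb v.
  by rewrite (const_codeE cb wv); exact: (cut_closed1 cb).
- by apply: closed_openC; exact: (closed_gap cb).
- by move=> w wv Jw; have : (J `&` const_code v) w by []; rewrite gap_const.
- by rewrite setDE setIAC setICl set0I measure0 lee_fin ltW.
Qed.

End sandwich.

Context (e : Z2) (e0 : 0 < L e).
Notation J := (@exhaust T b e).

Lemma compact_measure_fin (K : set T) : compact K -> K `<=` interior -> (m K < +oo)%E.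
Proof.
move=> cK Ki; have [k Kk] := compact_exhaust cb e0 cK Ki.
apply: le_lt_trans (mfin (- (e *+ k)) (e *+ k)).
apply: le_measure; rewrite ?inE //; last exact: (measurable_gap cb).
by apply: measurable_closed; exact: compact_closed (cut_hausdorff cb) cK.
Qed.

Lemma outer_regular (A : set borel) : measurable A -> A `<=` interior ->
  m A = ereal_inf [set m U | U in [set U : set T |
                [/\ open U, A `<=` U & U `<=` interior]]].
Proof.
move=> mA Ai; apply/eqP; rewrite eq_le; apply/andP; split.
  apply: le_ereal_inf_tmp => _ [U [oU AU Ui] <-].
  by apply: le_measure; rewrite ?inE //; exact: measurable_open.
apply/lee_addgt0Pr => d d0.
have di i : 0 < d / (2 ^ i.+1)%:R by rewrite divr_gt0 // ltr0n expn_gt0.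
have /choice [U UP] : forall i, exists U : set T, [/\ open U, A `<=` U &
    (m ((U `\` A) `&` J i : set borel) <= (d / (2 ^ i.+1)%:R)%:E)%E].
  move=> i; have [K [U [cK oU KA AU mU]]] := borel_sandwiched (- (e *+ i)) (e *+ i) mA (di i).
  exists U; split=> //; apply: le_trans mU; apply: le_measure; rewrite ?inE.
  - apply: measurableI; last exact: (measurable_gap cb).
    by apply: measurableD => //; exact: measurable_open.
  - apply: measurableI; last exact: (measurable_gap cb).
    by apply: measurableD; [exact: measurable_open|exact: measurable_closed].
  - by move=> w [[Uw nA] Jw]; split=> //; split=> // /KA.
(* Each [U i] is controlled only inside [J i], so it is cut down to [J i] before the union; the
   excess over [A] then sums to at most [d]. *)
pose V := \bigcup_i (U i `&` J i).
have oV : open V.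
  by apply: bigcup_open => i _; apply: openI; [case: (UP i)|exact: (open_gap cb)].
have AV : A `<=` V.
  move=> w Aw; have : interior w by exact: Ai.
  rewrite -(bigcup_exhaust cb e0) => -[i _ Jw]; exists i => //; split=> //.
  by case: (UP i) => _ + _; exact.
have mV : measurable (V : set borel) by exact: measurable_open.
apply: le_trans (_ : m V <= _)%E.
  apply: ereal_inf_lbound; exists V => //; split=> //.
  by move=> w [i _ [_]]; exact: gap_interior.
rewrite (measureDI m mV mA) addeC; apply: leeD.
  exact: measureIr.
apply: le_trans (epsilon_trick0 xpredT (ltW d0)).
apply: le_trans (_ : (\sum_(i <oo) m ((U i `\` A) `&` J i : set borel) <= _)%E); last first.
  by apply: lee_nneseries => // i _; case: (UP i).
apply: measure_sigma_subadditive.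
- move=> i; apply: measurableI; last exact: (measurable_gap cb).
  by apply: measurableD => //; apply: measurable_open; case: (UP i).
- exact: measurableD.
- by move=> w [[i _ [Uw Jw]] nA]; exists i.
Qed.

(** [A] is the increasing union of its traces on the compact sets [J i], and the sandwich gives a
    compact subset of each trace losing at most [d]. Passing to the limit in [i] covers the case of
    infinite [m A] too. *)
Lemma inner_regular (A : set borel) : measurable A -> A `<=` interior ->
  m A = ereal_sup [set m K | K in [set K : set T | compact K /\ K `<=` A]].
Proof.
move=> mA Ai; apply/eqP; rewrite eq_le; apply/andP; split; last first.
  apply: ge_ereal_sup => _ [K [cK KA] <-].
  apply: le_measure; rewrite ?inE //; apply: measurable_closed.
  exact: compact_closed (cut_hausdorff cb) cK.
have mJ i : measurable (J i : set borel) by exact: (measurable_gap cb).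
have mAJ i : measurable (A `&` J i) by exact: measurableI.
have AE : \bigcup_i (A `&` J i) = A.
  by rewrite -setI_bigcupr (bigcup_exhaust cb e0) setIidl.
have mcvg : m \o (fun i => A `&` J i) @ \oo --> m A.
  rewrite -{2}AE; apply: nondecreasing_cvg_mu => //; first by rewrite AE.
  by move=> i j ij; apply/subsetPset; apply: setIS; exact: (exhaust_mono cb e0).
rewrite -(cvg_lim _ mcvg) //; apply: lime_le; first exact: cvgP mcvg.
apply: nearW => i /=; apply/lee_addgt0Pr => d d0.
have [K [U [cK oU KA AU mU]]] := borel_sandwiched (- (e *+ i)) (e *+ i) mA d0.
have mK : measurable (K : set borel) by exact: measurable_closed.
rewrite (measureDI m (mAJ i) mK) addeC; apply: leeD.
  apply: ereal_sup_ubound; exists (A `&` J i `&` K) => //=; split; last by move=> w [[]].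
  have -> : A `&` J i `&` K = J i `&` K.
    by apply/seteqP; split=> w; [move=> [[]]|move=> [Jw Kw]; split=> //; split=> //; exact: KA].
  apply: (subclosed_compact _ (cut_compact cb)) => //.
  by apply: closedI => //; exact: (closed_gap cb).
apply: le_trans mU; apply: le_measure; rewrite ?inE; first exact: measurableD.
  apply: measurableI; last exact: mJ.
  by apply: measurableD => //; exact: measurable_open.
by move=> w [[Aw Jw] nK]; split=> //; split=> //; exact: AU.
Qed.

End cut_system_regular.

(** * Classification of invariant and of ergodic measures *)

Section cut_system_classification.
Context {R : realType} {L : Z2 -> R} {T : ptopologicalType} {b : T -> Z2 -> bool}.
Context (cb : cut_coding L b).
Context {s : Z2 -> T -> T} (sb : forall gamma w n, b (s gamma w) n = b w (n + gamma)).

Notation borel := (g_sigma_algebraType (@open T)).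
Notation gap := (@gap T b).
Notation interior := (@cut_interior T b).
Notation const_code := (@const_code T b).

Lemma cut_shift_continuous gamma : continuous (s gamma).
Proof.
move=> w U /(cut_nbhs cb) [l lU]; apply/(cut_nbhs cb).
exists [seq n + gamma | n <- l] => w' ww'; apply: lU => n nl.
by rewrite !sb; apply: ww'; exact: map_f.
Qed.

Lemma cut_shift_measurable gamma (A : set borel) :
  measurable A -> measurable (s gamma @^-1` A : set borel).
Proof.
pose D := [set B : set T | measurable (s gamma @^-1` B : set borel)].
have sD : <<s @open T >> `<=` D; last exact: sD.
apply: smallest_sub => [|U oU]; last first.
  apply: measurable_open; move: U oU; apply/continuousP; exact: cut_shift_continuous.
rewrite /D; split; rewrite /mkset.
- by rewrite preimage_set0; exact: measurable0.
- by move=> B mB; rewrite setTD preimage_setC; exact: measurableC.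
- by move=> F mF; rewrite preimage_bigcup; exact: bigcupT_measurable.
Qed.

Definition finite_invariant (m : {measure set borel -> \bar R}) : Prop :=
  [/\ gap_finite (b := b) m, (m (~` interior) < +oo)%E & shift_invariant (s := s) m].

Lemma gap_compact n k : compact (gap n k).
Proof. by apply: (subclosed_compact _ (cut_compact cb)) => //; exact: (closed_gap cb). Qed.

(** Gaps are compact subsets of the interior, so local finiteness bounds them; conversely,
    finiteness on gaps yields both regularity conditions. *)
Lemma finite_invariantP (m : {measure set borel -> \bar R}) :
  finite_invariant m <->
  [/\ [/\ forall K : set T, compact K -> K `<=` interior -> (m K < +oo)%E,
      forall A : set borel, measurable A -> A `<=` interior ->
        m A = ereal_inf [set m U | U in [set U : set T |
                [/\ open U, A `<=` U & U `<=` interior]]] &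
      forall A : set borel, measurable A -> A `<=` interior ->
        m A = ereal_sup [set m K | K in [set K : set T | compact K /\ K `<=` A]]],
    (m (~` interior) < +oo)%E & shift_invariant (s := s) m].
Proof.
have [e e0] := cut_nontrivial cb.
split=> [[mf mi ms]|[[mc _ _] mi ms]]; split=> //.
  split; first exact: (compact_measure_fin cb mf e0).
    exact: (outer_regular cb mf e0).
  exact: (inner_regular cb mf e0).
by move=> n k; apply: mc; [exact: gap_compact|exact: gap_interior].
Qed.

Context (mu : {measure set borel -> \bar R}).
Context (mufin : gap_finite (b := b) mu) (muinv : shift_invariant (s := s) mu).
Context (mu_interior : mu interior <> 0%E) (mu_boundary : mu (~` interior) = 0%E).
Context (wp wm : borel) (wpE : b wp = fun=> true) (wmE : b wm = fun=> false).

Lemma mu_interiorE (A : set borel) : measurable A -> mu A = mu (A `&` interior).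
Proof.
move=> mA; have mi := measurable_interior cb.
rewrite (measureDI mu mA mi) (@subset_measure0 _ _ _ mu _ (~` interior)) ?add0e //.
- exact: measurableD.
- exact: measurableC.
Qed.

Lemma shift_const v (w : T) gamma : b w = (fun=> v) -> s gamma w = w.
Proof. by move=> wv; apply: (cut_inj cb); apply/funext => n; rewrite sb wv. Qed.

Lemma dirac_shift v (w : borel) gamma (A : set borel) : b w = (fun=> v) ->
  \d_w (s gamma @^-1` A) = \d_w A :> \bar R.
Proof.
move=> wv; rewrite !diracE; have -> // : (w \in s gamma @^-1` A) = (w \in A).
by apply/idP/idP; rewrite !inE /preimage /mkset (shift_const gamma wv).
Qed.

Lemma measure_point (m : {measure set borel -> \bar R}) (w : borel) (A : set borel) :
  m (A `&` [set w]) = (m [set w] * \d_w A)%E.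
Proof.
rewrite diracE; have [Aw|nAw] := pselect (A w).
  by rewrite mem_set // mule1 setIidr // => _ ->.
rewrite memNset // mule0 [X in m X](_ : _ = set0) ?measure0 //.
by rewrite -subset0 => w' [Aw' w'w]; apply: nAw; rewrite -w'w.
Qed.

Lemma measure_decomposition (m : {measure set borel -> \bar R}) (A : set borel) :
  measurable A ->
  m A = (m (A `&` interior) + m [set wp] * \d_wp A + m [set wm] * \d_wm A)%E.
Proof.
move=> mA; have mi := measurable_interior cb.
have mp := measurable_point cb wp; have mm := measurable_point cb wm.
have AC : A `\` interior = (A `&` [set wp]) `|` (A `&` [set wm]).
  rewrite setDE interiorC setIUr.
  by rewrite (const_codeE cb (w := wp) wpE) (const_codeE cb (w := wm) wmE).
rewrite (measureDI m mA mi) addeC -addeA; congr (_ + _)%E.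
rewrite -!measure_point -measureU; [by rewrite AC|exact: measurableI|exact: measurableI|].
rewrite -subset0 => w [[_ ->] [_ wpm]].
by have := congr1 (fun w => b w 0) wpm; rewrite wpE wmE.
Qed.

Lemma dirac_gap0 n k v (w : borel) : b w = (fun=> v) -> \d_w (gap n k) = 0%E :> \bar R.
Proof.
move=> wv; rewrite diracE memNset // => -[]; rewrite wv; by case: v {wv}.
Qed.

Lemma dirac_interior0 v (w : borel) : b w = (fun=> v) -> \d_w interior = 0%E :> \bar R.
Proof.
by move=> wv; rewrite diracE memNset // => -[[n +] [k +]]; rewrite wv; case: v {wv}.
Qed.

(** The part of [m] on the interior is a multiple of [mu] by uniqueness, and what remains is two
    atoms, of finite mass because the complement of the interior has finite measure. *)
Lemma classification (m : {measure set borel -> \bar R}) :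
  finite_invariant m <-> exists a b c : R, [/\ 0 <= a, 0 <= b, 0 <= c &
    forall A : set borel, measurable A ->
      m A = (a%:E * mu A + b%:E * \d_wp A + c%:E * \d_wm A)%E].
Proof.
have mi := measurable_interior cb.
have mp := measurable_point cb wp; have mm := measurable_point cb wm.
split=> [[mf mo ms]|[a [p [q [a0 p0 q0 mE]]]]].
  have [a a0 aE] := invariant_measure_unique cb sb mf ms mufin muinv mu_interior.
  have fin (w : borel) v : b w = (fun=> v) -> (m [set w] < +oo)%E.
    move=> wv; apply: le_lt_trans mo; apply: le_measure; rewrite ?inE.
    - exact: (measurable_point cb).
    - exact: measurableC.
    - by move=> _ -> [[n +] [k +]]; rewrite wv; case: v {wv}.
  exists a, (fine (m [set wp])), (fine (m [set wm])); split=> //.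
  move=> A mA; rewrite (measure_decomposition m mA) aE // -mu_interiorE //.
  by rewrite !fineK // ge0_fin_numE // (fin _ _ wpE, fin _ _ wmE).
split.
- move=> n k; rewrite mE; last exact: (measurable_gap cb).
  rewrite (dirac_gap0 _ _ wpE) (dirac_gap0 _ _ wmE) !mule0 !adde0.
  by rewrite lte_mul_pinfty.
- rewrite mE; last exact: measurableC.
  by rewrite mu_boundary mule0 add0e !diracE -!EFinM -EFinD ltry.
- move=> gamma A mA; rewrite !mE //; last exact: cut_shift_measurable.
  by rewrite muinv // (dirac_shift _ _ wpE) (dirac_shift _ _ wmE).
Qed.

Definition cut_ergodic (m : {measure set borel -> \bar R}) : Prop :=
  m setT != 0%E /\
  forall A : set borel, measurable A ->
    (forall gamma, s gamma @^-1` A = A) -> m A = 0%E \/ m (~` A) = 0%E.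

Definition multiple (m1 m2 : {measure set borel -> \bar R}) : Prop :=
  exists2 c : R, 0 < c & forall A : set borel, measurable A -> m1 A = (c%:E * m2 A)%E.

Lemma mu_ergodic : cut_ergodic mu.
Proof.
have mi := measurable_interior cb.
split.
  by rewrite mu_interiorE // setTI; exact/eqP.
move=> A mA Ainv; pose muA : {measure set borel -> \bar R} := mrestr mu mA.
have muAE B : muA B = mu (B `&` A) by [].
have fA : gap_finite (b := b) muA.
  move=> n k; rewrite muAE; apply: le_lt_trans (mufin n k).
  by apply: measureIl => //; exact: (measurable_gap cb).
have iA : shift_invariant (s := s) muA.
  move=> gamma B mB; rewrite !muAE -{1}(Ainv gamma) -preimage_setI muinv //.
  exact: measurableI.
have [c c0 cE] := invariant_measure_unique cb sb fA iA mufin muinv mu_interior.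
(* The restriction of [mu] to [A] vanishes on the complement of [A], so [c] times the measure of
   that complement is 0; if [c = 0], the restriction itself is zero. *)
have := cE _ (measurableC mA); rewrite muAE setIAC setICl set0I measure0.
rewrite -mu_interiorE; last exact: measurableC.
move/esym/eqP; rewrite mule_eq0 => /orP[/eqP c00|/eqP]; last by right.
left; have := cE _ measurableT; rewrite muAE c00 mul0e setTI setIC => <-.
exact: mu_interiorE.
Qed.

Lemma dirac_ergodic (w : borel) : cut_ergodic \d_w.
Proof.
pose d : {measure set borel -> \bar R} := \d_w.
have dE (B : set borel) : d B = ((w \in B)%:R)%:E by exact: diracE.
split; first by rewrite -/d dE in_setT eqe; exact: oner_neq0.
move=> A mA _; rewrite -/d !dE; have [Aw|nAw] := pselect (A w).
  by right; rewrite memNset.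
by left; rewrite memNset.
Qed.

Lemma multiple_ergodic (m1 m2 : {measure set borel -> \bar R}) :
  multiple m1 m2 -> cut_ergodic m2 -> cut_ergodic m1.
Proof.
move=> [c c0 cE] [n0 erg]; split.
  by rewrite cE // mule_eq0 (negbTE n0) orbF eqe gt_eqF.
move=> A mA Ainv; rewrite !cE //; last exact: measurableC.
by case: (erg A mA Ainv) => ->; rewrite mule0; [left|right].
Qed.

(** Each fixed point is an invariant set. If [m] charges anything outside it, ergodicity makes the
    point null, so at most one of the three coefficients is nonzero. *)
Lemma ergodic_classification (m : {measure set borel -> \bar R}) :
  finite_invariant m /\ cut_ergodic m <->
  [\/ multiple m mu, multiple m \d_wp | multiple m \d_wm].
Proof.
have mi := measurable_interior cb.
have mp := measurable_point cb wp; have mm := measurable_point cb wm.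
split; last first.
  case=> mE; split.
  - apply/classification; case: mE => c c0 cE; exists c, 0, 0; split=> //; first exact: ltW.
    by move=> A mA; rewrite cE // !mul0e !adde0.
  - exact: multiple_ergodic mE mu_ergodic.
  - apply/classification; case: mE => c c0 cE; exists 0, c, 0; split=> //; first exact: ltW.
    by move=> A mA; rewrite cE // !mul0e add0e adde0.
  - exact: multiple_ergodic mE (dirac_ergodic _).
  - apply/classification; case: mE => c c0 cE; exists 0, 0, c; split=> //; first exact: ltW.
    by move=> A mA; rewrite cE // !mul0e !add0e.
  - exact: multiple_ergodic mE (dirac_ergodic _).
move=> [/classification [a [p [q [a0 p0 q0 mE]]]] [mT erg]].
have wpm : wp <> wm by move=> /(congr1 (fun w => b w 0)); rewrite wpE wmE.
have inv_point v (w : borel) gamma : b w = (fun=> v) -> s gamma @^-1` [set w] = [set w].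
  move=> wv; apply/seteqP; split=> w'.
    move=> /= sw'; apply: (cut_inj cb); apply/funext => n.
    by have := congr1 (fun x => b x (n - gamma)) sw'; rewrite sb subrK wv.
  by move=> ->; exact: shift_const wv.
have mpE : m [set wp] = p%:E.
  rewrite mE // !diracE mem_set // memNset; last by move=> /esym.
  rewrite mule1 mule0 adde0 mu_interiorE // [X in mu X](_ : _ = set0) ?measure0 ?mule0 ?add0e //.
  by rewrite -subset0 => w [-> [[n +] _]]; rewrite wpE.
have mmE : m [set wm] = q%:E.
  have wp_wm : (wp \in [set wm]) = false by rewrite memNset.
  have wm_wm : (wm \in [set wm]) = true by rewrite mem_set.
  rewrite mE // !diracE wp_wm wm_wm.
  rewrite mule1 mule0 adde0 mu_interiorE // [X in mu X](_ : _ = set0) ?measure0 ?mule0 ?add0e //.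
  by rewrite -subset0 => w [-> [_ [n +]]]; rewrite wmE.
have miE : m interior = (a%:E * mu interior)%E.
  by rewrite mE // (dirac_interior0 wpE) (dirac_interior0 wmE) !mule0 !adde0.
have muC (w : borel) : wp = w \/ wm = w -> interior `<=` ~` [set w].
  by move=> [] <- w' + ww'; rewrite ww' => -[[n +] [k +]]; rewrite ?wpE ?wmE.
have null0 A B : measurable A -> measurable B -> A `<=` B -> m B = 0%E -> m A = 0%E.
  by move=> mA mB AB B0; exact: subset_measure0 AB B0.
have [a00|an0] := eqVneq a 0; last first.
  have min0 : m interior <> 0%E.
    by move=> /eqP; rewrite miE mule_eq0 eqe (negbTE an0) => /eqP.
  have pz : p = 0.
    apply: EFin_inj; rewrite -mpE.
    case: (erg _ mp (fun gamma => inv_point _ _ gamma wpE)) => // mC0.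
    by case: min0; apply: null0 mC0 => //; [exact: measurableC|apply: muC; left].
  have qz : q = 0.
    apply: EFin_inj; rewrite -mmE.
    case: (erg _ mm (fun gamma => inv_point _ _ gamma wmE)) => // mC0.
    by case: min0; apply: null0 mC0 => //; [exact: measurableC|apply: muC; right].
  apply: Or31; exists a; first by rewrite lt_def an0.
  by move=> A mA; rewrite mE // pz qz !mul0e !adde0.
have [p00|pn0] := eqVneq p 0; last first.
  apply: Or32; exists p; first by rewrite lt_def pn0.
  have qz : q = 0.
    apply: EFin_inj; rewrite -mmE.
    case: (erg _ mm (fun gamma => inv_point _ _ gamma wmE)) => // mC0.
    have : m [set wp] = 0%E.
      by apply: null0 mC0 => //; [exact: measurableC|move=> _ ->].
    by rewrite mpE => -[] /eqP; rewrite (negbTE pn0).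
  by move=> A mA; rewrite mE // a00 qz !mul0e add0e adde0.
apply: Or33; exists q; last by move=> A mA; rewrite mE // a00 p00 !mul0e !add0e.
(* If all three coefficients vanished, [m] would be zero, which [mT] excludes. *)
rewrite lt_def q0 andbT; apply: contra_neq mT => q00.
by rewrite mE // a00 p00 q00 !mul0e !adde0.
Qed.

End cut_system_classification.

(** * Discrete and dense slopes *)

Section slope_group.
Context {R : realType} {L : Z2 -> R} {T : ptopologicalType} {b : T -> Z2 -> bool}.
Context (cb : cut_coding L b).

Lemma cut_LMz n (k : int) : L (n *~ k) = k%:~R * L n.
Proof.
have Lnat j : L (n *~ Posz j) = (Posz j)%:~R * L n.
  by rewrite -pmulrn (cut_LMn cb) -mulr_natl.
case: k => j //; rewrite NegzE mulrNz (cut_LN cb) Lnat.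
by rewrite rmorphN mulNr.
Qed.

Definition dense_slopes : Prop := forall x y : R, x < y -> exists n, x < L n < y.

Definition cyclic_slopes : Prop :=
  exists2 g, 0 < L g & forall n, exists k : int, L n = k%:~R * L g.

Lemma small_dense : (forall d : R, 0 < d -> exists g, 0 < L g < d) -> dense_slopes.
Proof.
move=> small x y xy; have [|g /andP[g0 gd]] := small (y - x); first by rewrite subr_gt0.
exists (g *~ (Num.floor (x / L g) + 1)); rewrite cut_LMz.
have h1 := floorD1_gt (x / L g); have h2 := floor_le (x / L g).
rewrite ltr_pdivrMr // in h1; rewrite ler_pdivlMr // in h2.
rewrite h1 /= intrD mulrDl mul1r.
by apply: le_lt_trans (_ : x + L g < _); [rewrite lerD2r|rewrite -ltrBrDl].
Qed.

(** Division with remainder: a nonzero remainder would be a positive level below [L g]. *)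
Lemma minimal_cyclic g : 0 < L g -> (forall h, 0 < L h -> L g <= L h) -> cyclic_slopes.
Proof.
move=> g0 gmin; exists g => // n; exists (Num.floor (L n / L g)); set k := Num.floor _.
have h1 := floorD1_gt (L n / L g); have h2 := floor_le (L n / L g).
rewrite ltr_pdivrMr // intrD mulrDl mul1r -/k in h1; rewrite ler_pdivlMr // -/k in h2.
apply/eqP; rewrite eq_sym eq_le h2 /= leNgt; apply/negP => lt.
have := gmin (n - g *~ k); rewrite (cut_additive cb) cut_LMz subr_gt0 => /(_ lt).
by rewrite leNgt => /negP; apply; rewrite ltrBlDl.
Qed.

Lemma dense_or_cyclic : dense_slopes \/ cyclic_slopes.
Proof.
have [small|/existsNP[d]] := pselect (forall d : R, 0 < d -> exists g, 0 < L g < d).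
  by left; exact: small_dense.
move=> /not_implyP[d0 nsmall]; right.
have ge_d g : 0 < L g -> d <= L g.
  by move=> g0; rewrite leNgt; apply/negP => gd; apply: nsmall; exists g; rewrite g0 gd.
(* Distinct levels differ by at least [d]. For the least [j] such that a positive level is at most
   [j d], a smaller positive level would be at most [(j - 1) d]; so the level found is minimal. *)
pose P j := `[< exists2 g, 0 < L g & L g <= j%:R * d >].
have exP : exists j, P j.
  have [e e0] := cut_nontrivial cb; exists (Num.truncn (L e / d)).+1.
  by apply/asboolP; exists e => //; rewrite -ler_pdivrMr // ltW // truncnS_gt.
have [j /asboolP[g g0 gj] jmin] := ex_minnP exP.
apply: (minimal_cyclic g0) => h h0; rewrite leNgt; apply/negP => hg.
have hgd : d <= L (g - h) by apply: ge_d; rewrite (cut_additive cb) subr_gt0.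
rewrite (cut_additive cb) in hgd.
case: j gj jmin => [|j] gj jmin; first by move: gj; rewrite mul0r leNgt g0.
have : (j < j)%N; last by rewrite ltnn.
apply: jmin; apply/asboolP; exists h => //.
by rewrite -natr1 mulrDl mul1r in gj; lra.
Qed.

(** Density would give a level strictly between 0 and [1 / q], hence an integer strictly between 0
    and 1. *)
Lemma discrete_cyclic (q : R) : 0 < q ->
  (forall n, exists k : int, q * L n = k%:~R) -> cyclic_slopes.
Proof.
move=> q0 qL; have [dense|//] := dense_or_cyclic.
have [|n /andP[n0 nq]] := dense 0 q^-1; first by rewrite invr_gt0.
have [k kE] := qL n.
have : 0 < q * L n < 1.
  by rewrite mulr_gt0 //= -ltr_pdivlMl // mulr1.
by rewrite kE ltr0z ltrz1; lia.
Qed.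

End slope_group.

(** The sites [(0, 1)] and [(1, 0)] have levels 1 and [- r]; both are integer multiples of one
    level, so their ratio is rational. *)
Lemma cyclic_slope_rational {R : realType} {T : ptopologicalType} {b : T -> Z2 -> bool}
    (r : R) : cut_coding (slope_form r%:E) b ->
  @cyclic_slopes R (slope_form r%:E) -> rational r.
Proof.
move=> cb [g g0 gL].
have [k1] := gL (0, 1); have [k2] := gL (1, 0); rewrite /= !mulr0 mulr1 subr0 sub0r => k2E k1E.
have k10 : k1%:~R != 0 :> R.
  by apply/eqP => k0; move/eqP: k1E; rewrite k0 mul0r oner_eq0.
exists (- (k2%:~R / k1%:~R)) => //.
rewrite rmorphN fmorph_div /= !rmorph_int -[r]opprK k2E; congr (- _).
by apply: (mulfI k10); rewrite mulrC divfK // mulrCA -k1E mulr1.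
Qed.

(** * Dense levels: the Cantor set *)

Section metrized.
Context {R : realType} {L : Z2 -> R} {T : ptopologicalType} {b : T -> Z2 -> bool}.

(** A copy of [T] indexed by [cb], so that a pseudometric built from the coding can be attached to
    it, as [homeomorphism_cantor_like] is applied to a pseudometric space. *)
Definition metrized (cb : cut_coding L b) : Type := T.

Context (cb : cut_coding L b).

HB.instance Definition _ := Pointed.on (metrized cb).
HB.instance Definition _ := Nbhs.on (metrized cb).

(* The conjunct [0 < d] is there for the triangle inequality, which is required
   for all radii, including negative ones. *)
Definition cut_ball (w : metrized cb) (d : R) (w' : metrized cb) : Prop :=
  0 < d /\ forall n : Z2, d <= (pickle n).+1%:R^-1 -> b w' n = b w n.

Let cut_ball_center (w : metrized cb) (d : R) : 0 < d -> cut_ball w d w.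
Proof. by []. Qed.

Let cut_ball_sym (w w' : metrized cb) (d : R) : cut_ball w d w' -> cut_ball w' d w.
Proof. by move=> [d0 ww']; split=> // n /ww'. Qed.

Let cut_ball_triangle (w w' w'' : metrized cb) (d d' : R) :
  cut_ball w d w' -> cut_ball w' d' w'' -> cut_ball w (d + d') w''.
Proof.
move=> [d0 ww'] [d'0 ww'']; split=> [|n ndd]; first exact: addr_gt0.
rewrite ww''; last by apply: le_trans ndd; rewrite lerDr ltW.
by apply: ww'; apply: le_trans ndd; rewrite lerDl ltW.
Qed.

Let cut_nbhsE : (nbhs : metrized cb -> _) = nbhs_ (entourage_ cut_ball).
Proof.
apply/funext => w; apply/funext => U; apply/propext; split.
  (* [N] bounds the indices of the sites in the window, so the radius [1 / (N + 1)] controls all of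
     them. *)
  move=> /(cut_nbhs cb) [l lU]; pose N := (\max_(n <- l) pickle n)%N.
  have N0 : 0 < N.+1%:R^-1 :> R by rewrite invr_gt0.
  exists [set ww | cut_ball ww.1 (N.+1%:R^-1) ww.2]; first by exists (N.+1%:R^-1).
  move=> w' /xsectionP [_ ww']; apply: lU => n nl; apply: ww'.
  rewrite lef_pV2 ?posrE // ler_nat ltnS.
  exact: (@leq_bigmax_seq _ _ predT).
move=> [A [d d0 dA] AU]; apply/(cut_nbhs cb).
exists (pmap unpickle (iota 0 (Num.truncn d^-1).+1)) => w' ww'.
apply: AU; apply/xsectionP; apply: dA; split=> // n dn; apply: ww'.
rewrite mem_pmap; apply/mapP; exists (pickle n); last by rewrite pickleK.
rewrite mem_iota /= add0n ltnS.
have : (pickle n).+1%:R <= d^-1 :> R by rewrite -[X in X <= _]invrK lef_pV2 ?posrE ?invr_gt0.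
move=> nd; rewrite truncn_ge_nat ?invr_ge0 ?(ltW d0) //.
by apply: le_trans nd; rewrite ler_nat.
Qed.

HB.instance Definition _ := Nbhs_isPseudoMetric.Build R (metrized cb)
  cut_nbhsE cut_ball_center cut_ball_sym cut_ball_triangle erefl.

Lemma open_metrized (U : set T) : open U -> open (U : set (metrized cb)).
Proof. by rewrite !openE. Qed.

Lemma closed_metrized (U : set T) : closed U -> closed (U : set (metrized cb)).
Proof. exact. Qed.

Lemma compact_metrized : compact [set: metrized cb].
Proof. exact: (cut_compact cb). Qed.

Lemma hausdorff_metrized : hausdorff_space (metrized cb).
Proof. exact: (cut_hausdorff cb). Qed.

Lemma zero_dimensional_metrized : zero_dimensional (metrized cb).
Proof.
move=> w w' ww'.
have [n nn] : exists n, b w n <> b w' n.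
  apply: contrapT => nex; move/eqP: ww'; apply; apply: (cut_inj cb).
  by apply/funext => n; apply: contrapT => nn; apply: nex; exists n.
exists [set v | b v n = b w n]; split=> //; last by move=> /esym.
split; first by apply: open_metrized; exact: (open_cut cb).
by apply: closed_metrized; exact: (closed_cut cb).
Qed.

(** An isolated [w] would be determined by a finite window, which leaves an open interval of levels
    undecided. A site [g] with its level there gives two cuts, one containing [g] and one not, that
    both agree with [w] on the window. *)
Lemma perfect_metrized : @dense_slopes R L -> perfect_set [set: metrized cb].
Proof.
move=> dense; apply/perfectTP => w; rewrite openE => /(_ w erefl) /(cut_nbhs cb) [l lw].
(* The levels between the highest outside site and the lowest inside site are undecided; where the
   window lacks one kind, or both, an arbitrary unit interval serves. *)
have [lo [hi [lohi hilo]]] : exists lo hi, lo < hi /\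
    {in l, forall n, if b w n then hi <= L n else L n <= lo}.
  have [hf|/hasPn hf] := boolP (has (fun n => ~~ b w n) l); last first.
    have [ht|/hasPn ht] := boolP (has (b w) l); last first.
      exists 0, 1; rewrite ltr01; split=> // n nl.
      by have := hf _ nl; have := ht _ nl; case: (b w n).
    have [m [_ wm] mmin] := seq_argmin L ht.
    exists (L m - 1), (L m); split; first by rewrite gtrBl.
    by move=> n nl; have := hf _ nl; rewrite negbK => wn; rewrite wn; exact: mmin.
  have [n0 [_ wn0] nmax] := seq_argmax L hf.
  have [ht|/hasPn ht] := boolP (has (b w) l); last first.
    exists (L n0), (L n0 + 1); split; first by rewrite ltrDl.
    by move=> n nl; have wn := ht _ nl; rewrite (negbTE wn); exact: nmax.
  have [m [_ wm] mmin] := seq_argmin L ht.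
  exists (L n0), (L m); split; first by apply: (cut_lt cb (w := w)).
  by move=> n nl; case: ifPn => wn; [exact: mmin|exact: nmax].
have [g /andP[log ghi]] := dense _ _ lohi.
have [|w1 w1E] := cut_surj cb (x := fun n => L g < L n).
  by move=> n m nm gn; exact: lt_le_trans nm.
have [|w2 w2E] := cut_surj cb (x := fun n => L g <= L n).
  by move=> n m nm gn; exact: le_trans nm.
have w1w : w1 = w.
  apply: lw => n nl; rewrite w1E; have := hilo _ nl; case: ifP => _ h.
    exact: lt_le_trans h.
  by apply/negbTE; rewrite -leNgt; apply: le_trans h (ltW _).
have w2w : w2 = w.
  apply: lw => n nl; rewrite w2E; have := hilo _ nl; case: ifP => _ h.
    by apply: le_trans h; exact: ltW.
  by apply/negbTE; rewrite -ltNge; apply: le_lt_trans h _.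
have := congr1 (@^~ g) w1E; rewrite /= w1w -w2w w2E /= ltxx.
by rewrite lexx.
Qed.

End metrized.

Lemma dense_cantor {R : realType} {L : Z2 -> R} {T : ptopologicalType}
    {b : T -> Z2 -> bool} (cb : cut_coding L b) :
  @dense_slopes R L -> homeomorphic T cantor_space.
Proof.
move=> dense.
have [|f [cf clf]] := @homeomorphism_cantor_like R (metrized cb).
  split; [exact: perfect_metrized|exact: compact_metrized
         |exact: hausdorff_metrized|exact: zero_dimensional_metrized].
have [h fh hf] : bijective f by rewrite -setTT_bijective.
exists h, f; split=> //.
change (continuous (h : metrized cb -> cantor_space)).
apply/continuous_closedP => A cA.
rewrite [X in closed X](_ : _ = f @` A); first exact: clf.
apply/seteqP; split=> [w /= Aw|_ [x Ax <-]]; first by exists (h w).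
by rewrite /= fh.
Qed.

(** * Cyclic levels: the two-point compactification *)

Lemma nbhs_set_type {X : topologicalType} (A : set X) (x : A) (U : set A) :
  nbhs x U <-> exists2 V : set X, nbhs (set_val x : X) V & forall y : A, V (set_val y) -> U y.
Proof.
split.
  rewrite nbhsE => -[B [[V oV <-] Vx] BU].
  exists V; last exact: BU.
  by exists V; [split|].
move=> [V Vx VU].
have : nbhs x (set_val @^-1` V) by exact: (@initial_continuous _ _ set_val x V Vx).
by apply: filterS => y; exact: VU.
Qed.

Section two_point.
Context {R : realType} {L : Z2 -> R} {T : ptopologicalType} {b : T -> Z2 -> bool}.
Context (cb : cut_coding L b).
Context (g : Z2) (g0 : 0 < L g) (gL : forall n, exists k : int, L n = k%:~R * L g).

Notation twoZ := (two_point_compactification_Z R).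

Definition level (n : Z2) : \bar R := ((L n / L g)%:E)%E.

Lemma levelE n : exists k : int, L n = k%:~R * L g /\ level n = (k%:~R)%:E%E.
Proof.
have [k kE] := gL n; exists k; split=> //.
by rewrite /level kE mulfK // gt_eqF.
Qed.

Lemma level_mul (k : int) : level (g *~ k) = (k%:~R)%:E%E.
Proof. by rewrite /level (cut_LMz cb) mulfK // gt_eqF. Qed.

Lemma level_le n m : (level n <= level m)%E = (L n <= L m).
Proof. by rewrite lee_fin ler_pM2r // invr_gt0. Qed.

Lemma cut_at (x : \bar R) : exists w, b w = fun n => (x < level n)%E.
Proof.
apply: (cut_surj cb) => n m; rewrite -level_le => nm xn; exact: lt_le_trans nm.
Qed.

(** An integer is sent to the cut for which it is the highest normalized level outside; [-oo] gives
    the full cut and [+oo] the empty one. *)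
Definition of_twoZ (x : twoZ) : T := sval (cid (cut_at (set_val x))).

Lemma of_twoZE x n : b (of_twoZ x) n = (set_val x < level n)%E.
Proof. by rewrite /of_twoZ; case: cid => /= w ->. Qed.

Lemma twoZ_cases (x : twoZ) :
  [\/ set_val x = -oo%E, set_val x = +oo%E | exists k : int, set_val x = (k%:~R)%:E%E].
Proof. by have := set_valP x. Qed.

Lemma twoZ_lt_level (x y : twoZ) : (set_val x < set_val y)%E ->
  exists n, (set_val x < level n)%E && (level n <= set_val y)%E.
Proof.
have [yE|yE|[k yE]] := twoZ_cases y; rewrite ?yE.
- by rewrite ltNge leNye.
- have [xE|xE|[j xE]] := twoZ_cases x; rewrite ?xE //.
    by move=> _; exists 0; rewrite ltNye leey.
  move=> _; exists (g *~ (j + 1)); rewrite level_mul lte_fin ltr_int leey andbT.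
  by rewrite ltzD1.
- by move=> xk; exists (g *~ k); rewrite level_mul xk lexx.
Qed.

Lemma of_twoZ_inj : injective of_twoZ.
Proof.
move=> x y xy; apply/val_inj.
have sep (u v : twoZ) : of_twoZ u = of_twoZ v -> ~~ (set_val u < set_val v)%E.
  move=> uv; apply/negP => /twoZ_lt_level [n /andP[un nv]].
  by move: un; rewrite -of_twoZE uv of_twoZE ltNge nv.
apply/eqP; rewrite eq_le !leNgt.
by rewrite (sep _ _ xy) (sep _ _ (esym xy)).
Qed.

Lemma of_twoZ_surj w : exists x, of_twoZ x = w.
Proof.
have build (x : \bar R) (xZ : twoZ x) : (forall n, b w n = (x < level n)%E) ->
    exists x, of_twoZ x = w.
  move=> wx; exists (SigSub (mem_set xZ)); apply: (cut_inj cb); apply/funext => n.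
  by rewrite of_twoZE wx.
have [wi|/not_interior [wt|wf]] := pselect (cut_interior (b := b) w); last 2 first.
- by apply: (build -oo%E) => [|n]; [exact: Or31|rewrite wt ltNyr].
- by apply: (build +oo%E) => [|n]; [exact: Or32|rewrite wf ltNge leey].
have [[n wn] [m wm]] := wi.
have wup (i j : int) : i <= j -> b w (g *~ i) -> b w (g *~ j).
  by move=> ij; apply: (cut_up cb); rewrite !(cut_LMz cb) ler_pM2r // ler_int.
have [i iE] := gL n; have [j jE] := gL m.
have wi' : ~~ b w (g *~ i) by apply: (cut_false_le cb) wn _; rewrite (cut_LMz cb) iE.
have wj : b w (g *~ j) by apply: (cut_up cb) wm; rewrite (cut_LMz cb) jE.
(* Searching upwards from the outside level [i] finds the lowest level inside [w]; the integer
   sought is the one just below it. *)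
have exl : exists l : nat, b w (g *~ (i + l%:Z)).
  by exists `|j - i|%N; apply: wup wj; lia.
case: (ex_minnP exl) => l wl lmin.
have l0 : (0 < l)%N by case: l wl {lmin} => //; rewrite addr0 (negbTE wi').
have wl' : ~~ b w (g *~ (i + l%:Z - 1)).
  apply/negP => wl'; have := lmin l.-1.
  have -> : i + l.-1%:Z = i + l%:Z - 1 by lia.
  by move=> /(_ wl'); lia.
apply: (build ((i + l%:Z - 1)%:~R)%:E%E) => [|k]; first by apply: Or33; eexists.
have [kk [kE lkE]] := levelE k; rewrite lkE lte_fin ltr_int.
have Lk : L k = L (g *~ kk) by rewrite (cut_LMz cb).
have -> : b w k = b w (g *~ kk).
  by apply/idP/idP; apply: (cut_up cb); rewrite Lk.
case: ltP => hk; first by apply: wup wl; lia.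
by apply/negbTE; apply: contra wl'; apply: wup.
Qed.

Lemma of_twoZ_continuous : continuous of_twoZ.
Proof.
move=> x U /(cut_nbhs cb) [l lU]; rewrite /fmap /nbhs /=.
suff : nbhs x [set y | {in l, b (of_twoZ y) =1 b (of_twoZ x)}] by apply: filterS => y; exact: lU.
elim: l {lU} => [|n l IH]; first by apply: filterS filterT.
have : nbhs x [set y | b (of_twoZ y) n = b (of_twoZ x) n].
  apply/nbhs_set_type; have [k [_ kE]] := levelE n.
  case xn : (b (of_twoZ x) n); rewrite of_twoZE kE in xn.
    exists [set y | y < (k%:~R)%:E]%E; last by move=> y /= yk; rewrite of_twoZE kE.
    by apply: open_nbhs_nbhs; split; [exact: open_ereal_lt_ereal|].
  have kx : ((k%:~R)%:E <= set_val x)%E by rewrite leNgt xn.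
  (* Among the points of [twoZ], being above [k - 1] is the same as being at least [k], which makes
     this condition open. *)
  exists [set y | (k%:~R - 1)%:E < y]%E.
    apply: open_nbhs_nbhs; split; first exact: open_ereal_gt_ereal.
    by apply: lt_le_trans kx; rewrite lte_fin gtrBl.
  move=> y /=; rewrite of_twoZE kE.
  have [->|->|[j ->]] := twoZ_cases y.
  - by rewrite ltNge leNye.
  - by move=> _; apply/negbTE; rewrite -leNgt leey.
  - rewrite !lte_fin -[1]/(1%:~R) -intrB !ltr_int => kj; apply/negbTE; rewrite -leNgt; lia.
by apply: filterS2 IH => y e1 e2 i; rewrite inE => /predU1P[-> //|]; exact: e1.
Qed.

Lemma twoZ_homeomorphic : homeomorphic T twoZ.
Proof.
pose f w := sval (cid (of_twoZ_surj w)).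
have fK : cancel f of_twoZ by move=> w; rewrite /f; case: cid.
have Kf : cancel of_twoZ f by move=> x; apply: of_twoZ_inj; rewrite fK.
exists f, of_twoZ; split=> //; last exact: of_twoZ_continuous.
suff cf (x : twoZ) (U : set twoZ) : nbhs x U -> nbhs (of_twoZ x) (f @^-1` U).
  by move=> w U /cf; rewrite fK.
move=> /nbhs_set_type [V Vx VU]; apply/(cut_nbhs cb).
have bf w n : b w n = (set_val (f w) < level n)%E by rewrite -{1}[w]fK of_twoZE.
have [xE|xE|[k xE]] := twoZ_cases x; rewrite xE in Vx.
- case: Vx => M [_ MV].
  exists [:: g *~ (Num.floor M - 1)] => w' /(_ _ (mem_head _ _)).
  rewrite of_twoZE xE ltNye bf level_mul => wM; apply: VU; apply: MV.
  apply: lt_le_trans wM _; rewrite lee_fin rmorphB /=.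
  by have := floor_le_tmp M; lra.
- case: Vx => M [_ MV].
  exists [:: g *~ (Num.floor M + 1)] => w' /(_ _ (mem_head _ _)).
  rewrite of_twoZE xE bf level_mul => wM; apply: VU; apply: MV.
  have : ((Num.floor M + 1)%:~R%:E <= set_val (f w'))%E by rewrite leNgt wM ltNge leey.
  by apply: lt_le_trans; rewrite lte_fin; exact: floorD1_gt.
(* Level [k] outside and level [k + 1] inside pin the cut down. *)
exists [:: g *~ k; g *~ (k + 1)] => w' ww'.
have := ww' (g *~ k); rewrite mem_head => /(_ isT).
have := ww' (g *~ (k + 1)); rewrite !inE eqxx orbT => /(_ isT).
rewrite !of_twoZE xE !bf !level_mul !lte_fin !ltr_int ltrDl ltr01 ltxx.
move=> h1 /negbT; rewrite -leNgt => h2; apply: VU.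
suff -> : set_val (f w') = (k%:~R)%:E%E by exact: nbhs_singleton.
have [fE|fE|[j fE]] := twoZ_cases (f w'); rewrite fE // in h1 h2 *.
rewrite lte_fin ltr_int in h1; rewrite lee_fin ler_int in h2.
by congr (_%:~R%:E); lia.
Qed.

End two_point.

(** * The non-atomic and counting measures *)

Section counting_cut_measure.
Context {R : realType} {L : Z2 -> R} {T : ptopologicalType} {b : T -> Z2 -> bool}.
Context (cb : cut_coding L b).
Context {s : Z2 -> T -> T} (sb : forall gamma w n, b (s gamma w) n = b w (n + gamma)).

Notation borel := (g_sigma_algebraType (@open T)).
Notation gap := (@gap T b).
Notation interior := (@cut_interior T b).

(** A gap of width [L g] contains at most one cut, since no level lies strictly between its ends; a
    general gap is covered by finitely many of these. *)
Lemma finite_gap n m : @cyclic_slopes R L -> finite_set (gap n m).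
Proof.
move=> [g g0 gL].
have single k : finite_set (gap k (k + g)).
  have [->|/set0P[w [wk wkg]]] := eqVneq (gap k (k + g)) set0; first exact: finite_set0.
  apply: sub_finite_set (finite_set1 w) => w' [wk' wkg'] /=.
  apply: (cut_inj cb); apply/funext => n'.
  have [i iE] := gL n'; have [j jE] := gL k.
  have [ij|ji] := leP i j.
    have nk : L n' <= L k by rewrite iE jE ler_pM2r // ler_int.
    by rewrite (negbTE (cut_false_le cb wk nk)) (negbTE (cut_false_le cb wk' nk)).
  have kn : L (k + g) <= L n'.
    rewrite (cut_LD cb) iE jE -[X in _ + X]mul1r -mulrDl ler_pM2r //.
    by rewrite -[1]/(1%:~R) -intrD ler_int; lia.
  by rewrite (cut_up cb kn wkg) (cut_up cb kn wkg').
have finN N : forall k, finite_set (gap k (k + g *+ N)).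
  elim: N => [|N IH] k; first by rewrite addr0 gap_nn; exact: finite_set0.
  apply: (@sub_finite_set _ _ (gap k (k + g) `|` gap (k + g) (k + g + g *+ N))).
    have h1 : L k <= L (k + g) by rewrite (cut_LD cb) lerDl ltW.
    have h2 : L (k + g) <= L (k + g + g *+ N).
      by rewrite [leRHS](cut_LD cb) lerDl (cut_LMn cb) mulrn_wge0 // ltW.
    by rewrite mulrS addrA (gap_split cb h1 h2).
  by rewrite finite_setU; split.
have [N NE] := archimedes_L cb g0 (m - n).
apply: sub_finite_set (finN N n); apply: (gap_mono cb) => //.
by rewrite (cut_LD cb) -lerBlDl -(cut_additive cb); exact: NE.
Qed.

Lemma counting_bij_preimage (f h : T -> T) (A : set T) : cancel f h -> cancel h f ->
  counting (f @^-1` A) = counting A :> \bar R.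
Proof.
move=> fh hf; have -> : f @^-1` A = h @` A.
  apply/seteqP; split=> [w Aw|_ [w Aw <-]]; first by exists (f w).
  by rewrite /preimage /mkset hf.
have hinj : injective h by exact: can_inj hf.
rewrite /counting; have [finA|infA] := pselect (finite_set A).
  rewrite !asboolT //; last exact: finite_image.
  by rewrite fset_set_image // finmap.card_imfset.
rewrite !asboolF // => finhA; apply: infA.
have -> : A = f @` (h @` A).
  apply/seteqP; split=> [w Aw|_ [_ [w Aw <-] <-]]; last by rewrite hf.
  by exists (h w); [exists w|rewrite hf].
exact: finite_image.
Qed.

Definition counting_cut (c : {nonneg R}) : {measure set borel -> \bar R} :=
  mscale c (mrestr counting (measurable_interior cb)).

Lemma counting_cutE c A : counting_cut c A = (c%:num%:E * counting (A `&` interior))%E.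
Proof. by []. Qed.

Lemma counting_gap_finite c : @cyclic_slopes R L -> gap_finite (b := b) (counting_cut c).
Proof.
move=> cL n m; rewrite counting_cutE setIidl; last exact: gap_interior.
by rewrite lte_mul_pinfty // /counting asboolT ?ltry //; exact: finite_gap.
Qed.

Lemma shiftK gamma : cancel (s gamma) (s (- gamma)).
Proof. by move=> w; apply: (cut_inj cb); apply/funext => n; rewrite !sb subrK. Qed.

Lemma shiftVK gamma : cancel (s (- gamma)) (s gamma).
Proof. by move=> w; apply: (cut_inj cb); apply/funext => n; rewrite !sb addrK. Qed.

Lemma counting_invariant c : shift_invariant (s := s) (counting_cut c).
Proof.
move=> gamma A mA; rewrite !counting_cutE -{1}(preimage_interior sb gamma) -preimage_setI.
by rewrite (counting_bij_preimage _ (shiftK gamma) (shiftVK gamma)).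
Qed.

Lemma interior_nonempty : interior !=set0.
Proof.
have [w wE] : exists w, b w = fun n => 0 < L n.
  by apply: (cut_surj cb) => n m nm n0; exact: lt_le_trans nm.
have [e e0] := cut_nontrivial cb.
by exists w; split; [exists 0|exists e]; rewrite wE ?(cut_L0 cb) ?ltxx.
Qed.

Lemma counting_interior (c : {nonneg R}) : c%:num != 0 -> counting_cut c interior <> 0%E.
Proof.
move=> c0; rewrite counting_cutE setIid => /eqP; rewrite mule_eq0 eqe (negbTE c0) /=.
rewrite /counting; case: asboolP => // fini; rewrite eqe pnatr_eq0 finmap.cardfs_eq0.
move=> /eqP /(fset_set_set0 fini) i0.
by have [w] := interior_nonempty; rewrite i0.
Qed.

Lemma counting_boundary c : counting_cut c (~` interior) = 0%E.
Proof. by rewrite counting_cutE setICl -(set0I interior); exact: (measure0 (counting_cut c)). Qed.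

End counting_cut_measure.

Section lebesgue_cut_measure.
Context {R : realType} {L : Z2 -> R} {T : ptopologicalType} {b : T -> Z2 -> bool}.
Context (cb : cut_coding L b).
Context {s : Z2 -> T -> T} (sb : forall gamma w n, b (s gamma w) n = b w (n + gamma)).

Notation borel := (g_sigma_algebraType (@open T)).
Notation gap := (@gap T b).
Notation interior := (@cut_interior T b).
Notation const_code := (@const_code T b).

Lemma cut_line_ex (x : R) : exists w, b w = fun n => x < L n.
Proof.
by apply: (cut_surj cb) => n m nm xn; exact: lt_le_trans nm.
Qed.

Definition cut_line (x : measurableTypeR R) : borel := sval (cid (cut_line_ex x)).

Lemma cut_lineE x : b (cut_line x) = fun n => x < L n.
Proof. by rewrite /cut_line; case: cid. Qed.

Lemma cut_line_interior x : interior (cut_line x).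
Proof.
have [e e0] := cut_nontrivial cb; rewrite /cut_interior /mkset cut_lineE; split.
  have [N] : exists N : nat, - x <= N%:R * L e.
    exists (Num.truncn (- x / L e)).+1; rewrite -ler_pdivrMr //.
    by rewrite ltW // truncnS_gt.
  move=> xN; exists (- (e *+ N)); rewrite -leNgt (cut_LN cb) (cut_LMn cb) -mulr_natl.
  by rewrite lerNl.
exists (e *+ (Num.truncn (x / L e)).+1); rewrite (cut_LMn cb) -mulr_natl.
by rewrite -ltr_pdivrMr // truncnS_gt.
Qed.

(** The strict inequality in the code of [cut_line x] is what closes the interval on the left. *)
Lemma cut_line_gap n m : cut_line @^-1` gap n m = `[L n, L m[%classic.
Proof.
apply/seteqP; split=> x; rewrite /preimage /gap /mkset cut_lineE /= in_itv /= -leNgt.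
  by move=> [-> ->].
by move=> /andP[].
Qed.

Lemma cut_line_const v : cut_line @^-1` const_code v = set0.
Proof.
rewrite -subset0 => x xv; have := cut_line_interior x.
by move=> [[n +] [m +]]; rewrite xv; case: v {xv}.
Qed.

Lemma measurable_cut_line : measurable_fun setT cut_line.
Proof.
move=> _ A mA; rewrite setTI.
pose D := [set B : set T | measurable (cut_line @^-1` B)].
have sD : <<s @gap_family T b >> `<=` D.
  apply: smallest_sub => [|_ [[n [m ->]]|[v ->]]].
  - rewrite /D; split; rewrite /mkset.
    + by rewrite preimage_set0; exact: measurable0.
    + by move=> B mB; rewrite setTD preimage_setC; exact: measurableC.
    + by move=> F mF; rewrite preimage_bigcup; exact: bigcupT_measurable.
  - by rewrite /D /mkset cut_line_gap; exact: measurable_itv.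
  - by rewrite /D /mkset cut_line_const; exact: measurable0.
by apply: sD; rewrite -(borel_gap_family cb).
Qed.

(* The packed pushforward measure is named explicitly because the measurability
   of [cut_line] cannot be inferred. *)
Definition lebesgue_cut : {measure set borel -> \bar R} :=
  measure_function_pushforward__canonical__measure_function_Measure
    (@lebesgue_measure R) measurable_cut_line.

Lemma lebesgue_cutE A : lebesgue_cut A = lebesgue_measure (cut_line @^-1` A).
Proof. by []. Qed.

Lemma lebesgue_cut_gap n m : L n <= L m -> lebesgue_cut (gap n m) = (L m - L n)%:E.
Proof.
move=> nm; rewrite lebesgue_cutE cut_line_gap lebesgue_measure_itv /= lte_fin.
case: ltP => [_|mn]; first by rewrite EFinB.
by have -> : L m = L n by [apply/eqP; rewrite eq_le mn nm]; rewrite subrr.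
Qed.

Lemma lebesgue_cut_const v : lebesgue_cut (const_code v) = 0%E.
Proof. by rewrite lebesgue_cutE cut_line_const measure0. Qed.

Lemma lebesgue_cut_gap_finite : gap_finite (b := b) lebesgue_cut.
Proof.
move=> n m; have [nm|/ltW mn] := leP (L n) (L m); first by rewrite lebesgue_cut_gap // ltry.
by rewrite (gap_empty cb mn) measure0.
Qed.

(** A shift moves both ends of a gap by [L gamma] and keeps its length, so the pushforward agrees
    with [lebesgue_cut] on gaps. *)
Lemma lebesgue_cut_invariant : shift_invariant (s := s) lebesgue_cut.
Proof.
move=> gamma A mA.
have ms : measurable_fun setT (s gamma : borel -> borel).
  by move=> _ B mB; rewrite setTI; exact: (cut_shift_measurable cb sb).
pose m' : {measure set borel -> \bar R} :=
  measure_function_pushforward__canonical__measure_function_Measure lebesgue_cut ms.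
have m'E B : m' B = lebesgue_cut (s gamma @^-1` B) by [].
rewrite -m'E; apply: (eq_cut_measure cb) mA.
- by move=> n m; rewrite m'E (preimage_gap sb); exact: lebesgue_cut_gap_finite.
- by move=> v; rewrite m'E (preimage_const sb) lebesgue_cut_const ltry.
- move=> n m; rewrite m'E (preimage_gap sb).
  have [nm|/ltW mn] := leP (L n) (L m).
    rewrite !lebesgue_cut_gap // ?(cut_LD cb) ?lerD2r //.
    by congr (_%:E); ring.
  by rewrite !(gap_empty cb) ?measure0 ?(cut_LD cb) ?lerD2r.
- by move=> v; rewrite m'E (preimage_const sb).
Qed.

Lemma lebesgue_cut_interior : lebesgue_cut interior <> 0%E.
Proof.
have [e e0] := cut_nontrivial cb => i0.
have : (lebesgue_cut (gap 0%R e) <= lebesgue_cut interior)%E.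
  apply: le_measure; rewrite ?inE; [exact: (measurable_gap cb)
    |exact: (measurable_interior cb)|exact: gap_interior].
rewrite i0 lebesgue_cut_gap (cut_L0 cb) ?subr0 ?(ltW e0) //.
by rewrite lee_fin leNgt e0.
Qed.

Lemma lebesgue_cut_boundary : lebesgue_cut (~` interior) = 0%E.
Proof.
rewrite lebesgue_cutE [X in lebesgue_measure X](_ : _ = set0) ?measure0 //.
by rewrite -subset0 => x; apply; exact: cut_line_interior.
Qed.

End lebesgue_cut_measure.

(** * The magnetic hull *)

Section magnetic_hull.
Context {R : realType} (bp bm : R) (alpha : \bar R).
Context (hb : forall k : int, bp - bm <> k%:~R * (2 * pi)).

Notation hull := (hull bp bm alpha).
Notation borel := (hull_borel bp bm alpha).
Notation hcode := (@hcode R bp bm alpha).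
Notation L := (slope_form alpha).
Notation interior := (hull_interior (bp := bp) (bm := bm) (alpha := alpha)).

Lemma hull_code_const (w : hull) (v : bool) :
  hull_code w = cst (if v then expi bp else expi bm) <-> hcode w = fun=> v.
Proof.
split=> [wE|wv].
  apply/funext => n; rewrite /hcode wE /=; case: v {wE}; first exact: eqxx.
  by rewrite eq_sym (negbTE (expi_neq hb)).
by apply/funext => n; rewrite hull_code_hcode wv; case: v {wv}.
Qed.

Lemma hull_interiorE : interior = cut_interior (b := hcode).
Proof.
apply/seteqP; split=> w.
  move=> [/= wp wm]; split.
    apply: contrapT => nex; apply: wp; apply/(hull_code_const w true)/funext => n.
    by apply: contraT => wn; case: nex; exists n.
  apply: contrapT => nex; apply: wm; apply/(hull_code_const w false)/funext => n.
  by apply/negbTE/negP => wn; case: nex; exists n.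
move=> [[n wn] [m wm]]; split.
  by move/(hull_code_const w true) => wE; rewrite wE in wn.
by move/(hull_code_const w false) => wE; rewrite wE in wm.
Qed.

Definition rational_slope : Prop :=
  [\/ alpha = +oo%E, alpha = -oo%E | exists2 r : R, rational r & alpha = r%:E].

Lemma rational_slope_cyclic : rational_slope -> cyclic_slopes (L := L).
Proof.
have cb := hull_cut_coding alpha hb.
case=> [aE|aE|[r /rationalP [p [q rE]] aE]].
- by apply: (discrete_cyclic cb (@ltr01 R)) => n; exists (- n.1); rewrite aE /= mul1r rmorphN.
- by apply: (discrete_cyclic cb (@ltr01 R)) => n; exists n.1; rewrite aE /= mul1r.
(* The denominator [q] may be 0 here; the quotient is then 0 by convention, so the slope is 0. *)
have [q0|q0] := posnP q.
  apply: (discrete_cyclic cb (@ltr01 R)) => n; exists n.2.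
  by rewrite aE /= rE q0 invr0 mulr0 mul0r subr0 mul1r.
apply: (@discrete_cyclic _ _ _ _ cb q%:R) => [|n]; first by rewrite ltr0n.
exists (q%:Z * n.2 - p * n.1); rewrite aE /= rE rmorphB !rmorphM /=.
have q0' : q%:R != 0 :> R by rewrite pnatr_eq0 -lt0n.
by field.
Qed.

Lemma slope_rational (p q : int) : alpha = slope p q -> rational_slope.
Proof.
rewrite /slope; case: eqP => [_|_]; first by case: ifP => _; [apply: Or31|apply: Or32].
move=> aE; apply: Or33; exists (p%:~R / q%:~R) => //.
by exists (p%:~R / q%:~R) => //; rewrite fmorph_div /= !rmorph_int.
Qed.

Lemma rational_slopeP : rational_slope ->
  exists p q : int, [/\ coprimez p q, 0 <= q & alpha = slope p q].
Proof.
case=> [->|->|[_ [x _ <-] ->]].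
- by exists 1, 0.
- by exists (-1), 0.
exists (numq x), (denq x); split=> //; first exact: coprime_num_den.
by rewrite /slope denq_eq0 -{1}[x]divq_num_den fmorph_div /= !rmorph_int.
Qed.

(** The specification of the measure quantifies over all reduced pairs, while the constructed
    measure is scaled by one of them. Reduced pairs with positive [q] are unique, and for [q = 0]
    coprimality forces [p ^+ 2 = 1]. *)
Lemma slope_norm (p q p' q' : int) : coprimez p q -> 0 <= q -> coprimez p' q' -> 0 <= q' ->
  slope p q = slope p' q' :> \bar R -> p ^+ 2 + q ^+ 2 = p' ^+ 2 + q' ^+ 2.
Proof.
move=> pq q0 pq' q0'; rewrite /slope.
have coprime0 (t : int) : coprimez t 0 -> t ^+ 2 = 1.
  rewrite /coprimez gcdz0 => /eqP t1.
  by rewrite -[LHS]ger0_norm ?sqr_ge0 // normrX -abszE t1 expr1n.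
case: eqP => [q00|/eqP qn0]; case: eqP => [q00'|/eqP qn0'].
- by rewrite q00 in pq *; rewrite q00' in pq' *; rewrite (coprime0 p pq) (coprime0 p' pq').
- by case: ifP.
- by case: ifP.
move=> -[E].
have pqE : p * q' = p' * q.
  apply/eqP; rewrite -(eqr_int R) !rmorphM /=; apply/eqP.
  have h1 : q%:~R != 0 :> R by rewrite intr_eq0.
  have h2 : q'%:~R != 0 :> R by rewrite intr_eq0.
  by move/eqP: E; rewrite eqr_div // => /eqP ->; rewrite mulrC.
have qq : (q %| q')%Z.
  by rewrite -(Gauss_dvdzr (n := p)) 1?coprimez_sym // pqE dvdz_mull.
have qq' : (q' %| q)%Z.
  by rewrite -(Gauss_dvdzr (n := p')) 1?coprimez_sym // -pqE dvdz_mull.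
have eq_q : q = q'.
  have : (`|q| = `|q'|)%N by apply/eqP; rewrite eqn_dvd; apply/andP; split.
  by lia.
by move: pqE; rewrite eq_q in qn0 * => /(mulIf qn0') ->.
Qed.

Notation sigma := (@sigma_star R bp bm alpha).

Lemma invariant_measureP (m : {measure set borel -> \bar R}) :
  invariant_measure m <-> finite_invariant (b := hcode) (s := sigma) m.
Proof.
rewrite (finite_invariantP (hull_cut_coding alpha hb)).
by rewrite /invariant_measure /regular_on_interior hull_interiorE.
Qed.

Definition mu_spec (mu : {measure set borel -> \bar R}) : Prop :=
  [/\ is_mu_alpha mu, gap_finite (b := hcode) mu, shift_invariant (s := sigma) mu,
      mu (cut_interior (b := hcode)) <> 0%E & mu (~` cut_interior (b := hcode)) = 0%E].

Lemma rational_mu : rational_slope -> exists mu, mu_spec mu.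
Proof.
move=> ra; have cb := hull_cut_coding alpha hb; have cL := rational_slope_cyclic ra.
have [p [q [pq q0 aE]]] := rational_slopeP ra.
pose c : R := (Num.sqrt (p ^+ 2 + q ^+ 2)%:~R)^-1.
have c0 : 0 <= c by rewrite invr_ge0 sqrtr_ge0.
have cn0 : c != 0.
  rewrite invr_eq0 sqrtr_eq0 -ltNge ltr0z lt_def addr_ge0 ?sqr_ge0 // andbT.
  rewrite paddr_eq0 ?sqr_ge0 // !sqrf_eq0; apply/negP => /andP[/eqP p00 /eqP q00].
  by move: pq; rewrite p00 q00 /coprimez gcdz0.
exists (counting_cut cb (NngNum c0)); split.
- split=> [p' q' pq' q0' aE' A mA|r rI aE' A mA].
    rewrite counting_cutE hull_interiorE /= /c.
    by rewrite (slope_norm pq q0 pq' q0' (etrans (esym aE) aE')).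
  exfalso; case: ra => [|| [r' rr]]; rewrite aE' // => -[rE].
  by case: rI; rewrite rE.
- exact: counting_gap_finite.
- exact: (counting_invariant cb (hcode_sigma_star (alpha := alpha))).
- exact: counting_interior.
- exact: counting_boundary.
Qed.

Lemma irrational_mu (r : R) : irrational r -> alpha = r%:E -> exists mu, mu_spec mu.
Proof.
move=> rI aE; have cb := hull_cut_coding alpha hb.
exists (lebesgue_cut cb); split.
- split=> [p q pq q0 aE' A mA|r' rI' aE' A mA].
    exfalso; have := slope_rational aE'; case=> [|| [r' rr]]; rewrite aE // => -[rE].
    by case: rI; rewrite rE.
  rewrite lebesgue_cutE; congr (lebesgue_measure _).
  have LE n : L n = - r' * n.1%:~R + n.2%:~R by rewrite aE' /= mulNr addrC.
  have lineE x w : hull_code w = omega_line bp bm r' x <-> w = cut_line cb x.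
    split=> [wE|->].
      apply: (cut_inj cb); rewrite cut_lineE; apply/funext => n.
      rewrite /hcode wE /omega_line LE subr_gt0.
      by case: ltP => _; [exact: eqxx|rewrite eq_sym (negbTE (expi_neq hb))].
    by apply/funext => n; rewrite hull_code_hcode cut_lineE /omega_line LE subr_gt0.
  apply/seteqP; split=> [x Ax|x [w [Aw _] /lineE wE]].
    exists (cut_line cb x); last exact/lineE.
    by split=> //; rewrite hull_interiorE; exact: cut_line_interior.
  by rewrite /preimage /mkset -wE.
- exact: lebesgue_cut_gap_finite.
- exact: (lebesgue_cut_invariant cb (hcode_sigma_star (alpha := alpha))).
- exact: lebesgue_cut_interior.
- exact: lebesgue_cut_boundary.
Qed.

Lemma rational_or_irrational :
  rational_slope \/ exists2 r : R, irrational r & alpha = r%:E.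
Proof.
rewrite /rational_slope; case: alpha => [r| |].
- have [rr|rI] := pselect (rational r); last by right; exists r.
  by left; apply: Or33; exists r.
- by left; apply: Or31.
- by left; apply: Or32.
Qed.

Lemma irrational_dense (r : R) : irrational r -> alpha = r%:E -> dense_slopes (L := L).
Proof.
move=> rI aE; have cb := hull_cut_coding alpha hb.
have [//|cL] := dense_or_cyclic cb.
by case: rI; move: cb cL; rewrite aE => cb cL; exact: cyclic_slope_rational cb cL.
Qed.

End magnetic_hull.

Unset Implicit Arguments.

Theorem theorem1p1 (R : realType) (bp bm : R)
    (hb : forall k : int, bp - bm <> k%:~R * (2 * pi))
    (alpha : \bar R) :
  [/\ exists (wp wm : hull_borel bp bm alpha)
             (mu : {measure set (hull_borel bp bm alpha) -> \bar R}),
        [/\ hull_code wp = cst (expi bp) /\ hull_code wm = cst (expi bm),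
            is_mu_alpha mu,
            [/\ ~ proportional mu \d_wp, ~ proportional mu \d_wm &
                ~ proportional \d_wp \d_wm],
            (forall m : {measure set (hull_borel bp bm alpha) -> \bar R},
               invariant_measure m /\ ergodic m <->
               [\/ proportional m mu, proportional m \d_wp |
                   proportional m \d_wm]) &
            (forall m : {measure set (hull_borel bp bm alpha) -> \bar R},
               invariant_measure m <->
               exists a b c : R, [/\ 0 <= a, 0 <= b, 0 <= c &
                 forall A, measurable A ->
                   m A = (a%:E * mu A + b%:E * \d_wp A + c%:E * \d_wm A)%E])],
      ([\/ alpha = +oo%E, alpha = -oo%E |
           exists2 r : R, rational r & alpha = r%:E] ->
         homeomorphic (hull bp bm alpha) (two_point_compactification_Z R)) &
      (forall r : R, irrational r -> alpha = r%:E ->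
         homeomorphic (hull bp bm alpha) cantor_space)].
Proof.
have cb := hull_cut_coding alpha hb.
have sb := hcode_sigma_star (bp := bp) (bm := bm) (alpha := alpha).
split; last 2 first.
- move=> /(rational_slope_cyclic hb) [g g0 gL].
  exact: (twoZ_homeomorphic cb g0 gL).
- by move=> r rI aE; exact: (dense_cantor cb (irrational_dense hb rI aE)).
have [mu [muE mufin muinv mui mub]] : exists mu, @mu_spec R bp bm alpha mu.
  have [ra|[r rI aE]] := rational_or_irrational alpha; first exact: rational_mu.
  exact: irrational_mu rI aE.
have [wp wpE] := cut_point cb true; have [wm wmE] := cut_point cb false.
exists wp, wm, mu.
have mi := measurable_interior cb.
split=> //.
- by split; [exact/(hull_code_const hb wp true)|exact/(hull_code_const hb wm false)].
(* The interior separates [mu] from the point masses, and the point [wp] separates these from each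
   other. *)
- split=> -[c c0 muE'].
  + apply: mui; rewrite muE' //.
    exact: etrans (congr1 (mule c%:E) (dirac_interior0 wpE)) (mule0 _).
  + apply: mui; rewrite muE' //.
    exact: etrans (congr1 (mule c%:E) (dirac_interior0 wmE)) (mule0 _).
  + have : (\d_(wp : hull_borel bp bm alpha) [set wp] =
      c%:E * \d_(wm : hull_borel bp bm alpha) [set wp] :> \bar R)%E.
      exact: muE' (measurable_point cb wp).
    rewrite !diracE mem_set // memNset; last first.
      by move=> /(congr1 (fun w => hcode w 0)); rewrite wpE wmE.
    by rewrite mule0 => -[] /eqP; rewrite oner_eq0.
- move=> m; rewrite (invariant_measureP hb).
  exact: (ergodic_classification cb sb mufin muinv mui mub wpE wmE).
- move=> m; rewrite (invariant_measureP hb).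
  exact: (classification cb sb mufin muinv mui mub wpE wmE).
Qed.
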